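(* Suppose that $h$ is steep and that $f$ is $\mu$-strongly convex and $L$-smooth, both relative to $h$, with minimizer $x^*$ over $\mathcal X$. If (LMD) is run with $y_1=0$ and step-size $\gamma_t=\beta/t$, $0<\beta\le1/(pL)$, then, as $t\to\infty$, $$\mathbb E\big[\|x_t-x^*\|^2\big]=\begin{cases}\mathcal O\big(1/t^{p-1}\big)&\text{if }p<1+\beta\mu,\\ \mathcal O\big(\log t/t^{p-1}\big)&\text{if }p=1+\beta\mu,\\ \mathcal O\big(1/t^{\beta\mu}\big)&\text{if }p>1+\beta\mu.\end{cases}$$
   Context: Optimization setup. $\mathcal V$ is a real $n$-dimensional normed space with norm $\|\cdot\|$; $\mathcal Y=\mathcal V^*$ is its dual, with pairing $\langle y,x\rangle$ and dual norm $\|y\|_*=\sup\{\langle y,x\rangle:\|x\|\le1\}$. $\mathcal X\subset\mathcal V$ is a nonempty compact convex set. The objective $f:\mathcal V\to\mathbb R\cup\{\infty\}$ is convex, finite and continuous on $\mathcal X$, and $\partial f$ admits a continuous selection $\nabla f(x)\in\partial f(x)$ on $\operatorname{dom}\partial f=\{x:\partial f(x)\ne\varnothing\}$. Mirror setup. $h:\mathcal V\to\mathbb R\cup\{\infty\}$ is convex with $\operatorname{dom}h=\mathcal X$, continuous on $\mathcal X$; $\mathcal X_h=\operatorname{dom}\partial h$; $\partial h$ admits a continuous selection $\nabla h$ on $\mathcal X_h$; and for some $K>0$, $h(x')\ge h(x)+\langle\nabla h(x),x'-x\rangle+\frac K2\|x'-x\|^2$ for all $x\in\mathcal X_h$, $x'\in\mathcal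 X$. $h$ is steep if $\mathcal X_h$ equals the relative interior of $\mathcal X$. It is assumed that $\nabla f$ is defined on $\mathcal X_h$. $D(x',x)=h(x')-h(x)-\langle\nabla h(x),x'-x\rangle$ is the Bregman divergence and $Q(y)=\operatorname{argmax}_{x\in\mathcal X}\{\langle y,x\rangle-h(x)\}$ the mirror map. $f$ is $L$-smooth (resp. $\mu$-strongly convex, $\mu>0$) relative to $h$ if $f(x')\le f(x)+\langle\nabla f(x),x'-x\rangle+L\,D(x',x)$ (resp. $f(x')\ge f(x)+\langle\nabla f(x),x'-x\rangle+\mu D(x',x)$) for all $x\in\mathcal X_h$, $x'\in\mathcal X$. Algorithm. (LMD): $y_{t+1}=y_t-\gamma_tg_t$, $x_{t+1}=Q(y_{t+1})$, $t=1,2,\dots$, with $x_1=Q(y_1)$ and stochastic gradients $g_t=\nabla f(x_t)+U_t$, $U_t=U(x_t;\omega_t)$, where $\omega_1,\omega_2,\dots$ are i.i.d. random seeds and, for all $x\in\operatorname{dom}\partial f$, $\mathbb E[U(x;\omega)]=0$ and $\mathbb E[\|U(x;\omega)\|_*^p]\le\sigma^p$ for some $p\in(1,2]$. *)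

(* Defs.v *)
From HB Require Import structures.
From mathcomp Require Import all_boot all_order all_algebra.
From mathcomp Require Import finmap.
From mathcomp Require Import all_classical all_reals all_analysis.

Set Implicit Arguments.
Unset Strict Implicit.
Unset Printing Implicit Defensive.

Import Order.TTheory GRing.Theory Num.Theory.
Import numFieldNormedType.Exports.

Local Open Scope classical_set_scope.
Local Open Scope ring_scope.

(* The dual of a finite-dimensional space is the type of all linear
   functionals {linear V -> R^o}; the pairing <y, x> is the application [y x].
   dual_norm takes a plain function V -> R because bundled linear functionals
   carry no addition; it is only used on (differences of) linear ones. *)
Definition dual_norm (R : realType) (V : normedModType R) (phi : V -> R) : R :=
  sup [set phi x | x in [set x : V | `|x| <= 1]].

Definition edom (R : realType) (V : normedModType R) (f : V -> \bar R) : set V :=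
  [set x | (f x < +oo)%E].

(* Convexity of a function with values in R \cup {+oo}. *)
Definition econvex (R : realType) (V : normedModType R) (f : V -> \bar R) :=
  (forall x, f x != -oo%E) /\
  forall (x y : V) (t : R), 0 < t < 1 ->
    (f (t *: x + (1 - t) *: y)%R <= t%:E * f x + (1 - t)%R%:E * f y)%E.

Definition subdiff (R : realType) (V : normedModType R) (f : V -> \bar R)
    (x : V) : set {linear V -> R^o} :=
  [set y | forall x', (f x + (y (x' - x)%R)%:E <= f x')%E].

Definition dom_subdiff (R : realType) (V : normedModType R) (f : V -> \bar R) :
    set V :=
  [set x | subdiff f x !=set0].

(* Selections are total functions; their values off dom (subdiff f) are
   irrelevant.  Continuity is for the dual norm, relatively to
   dom (subdiff f). *)
Definition continuous_selection (R : realType) (V : normedModType R)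
    (f : V -> \bar R) (g : V -> {linear V -> R^o}) :=
  forall x, dom_subdiff f x ->
    subdiff f x (g x) /\
    dual_norm (g x' \- g x) @[x' --> within (dom_subdiff f) (nbhs x)] --> (0 : R).

Definition affine_set (R : realType) (V : normedModType R) (A : set V) :=
  forall (x y : V) (t : R), A x -> A y -> A (t *: x + (1 - t) *: y).

Definition affine_hull (R : realType) (V : normedModType R) (X : set V) : set V :=
  \bigcap_(A in [set A | affine_set A /\ X `<=` A]) A.

Definition relint (R : realType) (V : normedModType R) (X : set V) : set V :=
  [set x | X x /\ \forall z \near x, affine_hull X z -> X z].

Definition steep (R : realType) (V : normedModType R) (X : set V)
    (h : V -> \bar R) :=
  dom_subdiff h = relint X.

Definition bregman (R : realType) (V : normedModType R) (h : V -> \bar R)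
    (gradh : V -> {linear V -> R^o}) (x' x : V) : \bar R :=
  (h x' - h x - (gradh x (x' - x)%R)%:E)%E.

(* The mirror map as a set-valued argmax. *)
Definition mirror_map (R : realType) (V : normedModType R) (X : set V)
    (h : V -> \bar R) (y : {linear V -> R^o}) : set V :=
  [set x | X x /\ forall x', X x' -> ((y x')%:E - h x' <= (y x)%:E - h x)%E].

Definition rel_smooth (R : realType) (V : normedModType R) (X : set V)
    (f h : V -> \bar R) (gradf gradh : V -> {linear V -> R^o}) (L : R) :=
  forall x x', dom_subdiff h x -> X x' ->
    (f x' <= f x + (gradf x (x' - x)%R)%:E + L%:E * bregman h gradh x' x)%E.

Definition rel_strongly_convex (R : realType) (V : normedModType R) (X : set V)
    (f h : V -> \bar R) (gradf gradh : V -> {linear V -> R^o}) (mu : R) :=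
  forall x x', dom_subdiff h x -> X x' ->
    (f x + (gradf x (x' - x)%R)%:E + mu%:E * bregman h gradh x' x <= f x')%E.

Definition minimizer_over (R : realType) (V : normedModType R) (X : set V)
    (f : V -> \bar R) (xs : V) :=
  X xs /\ forall x, X x -> (f xs <= f x)%E.

Notation borel V := (g_sigma_algebraType (@open V)).

(* Joint measurability of an oracle in (point, seed), on D x S.  As V is
   finite-dimensional, dual-valued measurability is tested on each v : V.
   Pitfall: measurable_fun is vacuous on a nonmeasurable domain; D is meant to
   be Borel, as is dom (subdiff h) = relint X for a steep h. *)
Definition measurable_oracle (R : realType) (V : normedModType R)
    (dS : measure_display) (S : measurableType dS) (D : set V)
    (U : V -> S -> {linear V -> R^o}) :=
  forall v : V, measurable_fun ((D : set (borel V)) `*` [set: S])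
    (fun z : borel V * S => U z.1 z.2 v : R).

Definition mutually_independent (R : realType) (d : measure_display)
    (Omega : measurableType d) (P : probability Omega R)
    (dS : measure_display) (S : measurableType dS)
    (I : set nat) (X : nat -> Omega -> S) :=
  forall (J : {fset nat}) (A : nat -> set S),
    [set` J] `<=` I -> (forall i, measurable (A i)) ->
    P (\bigcap_(i in [set` J]) X i @^-1` A i) =
      (\prod_(i <- J) P (X i @^-1` A i))%E.

(* The seeds are indexed from 1; index 0 is unconstrained. *)
Definition iid_seeds (R : realType) (d : measure_display)
    (Omega : measurableType d) (P : probability Omega R)
    (dS : measure_display) (S : measurableType dS) (nu : probability S R)
    (omega : nat -> Omega -> S) :=
  [/\ forall t, (1 <= t)%N -> measurable_fun setT (omega t),
      forall t A, (1 <= t)%N -> measurable A -> P (omega t @^-1` A) = nu A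
    & mutually_independent P [set t | (1 <= t)%N] omega].

(* Pathwise lazy mirror descent, t = 1, 2, ..., started at y 1 = 0. *)
Definition lmd (R : realType) (V : normedModType R) (X : set V)
    (h : V -> \bar R) (gradf : V -> {linear V -> R^o})
    (Omega S : Type) (omega : nat -> Omega -> S) (U : V -> S -> {linear V -> R^o})
    (gamma : nat -> R) (y : nat -> Omega -> {linear V -> R^o}) (x : nat -> Omega -> V) :=
  [/\ forall w v, y 1 w v = 0,
      forall t w v, (1 <= t)%N ->
        y t.+1 w v =
          y t w v - gamma t * (gradf (x t w) v + U (x t w) (omega t w) v)
    & forall t w, (1 <= t)%N -> mirror_map X h (y t w) (x t w)].

(* Big-O as t -> oo for an extended-real sequence; it forces a t to be finite
   eventually. *)
Definition ebigO (R : realType) (a : nat -> \bar R) (b : nat -> R) :=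
  exists C : R, \forall t \near \oo, (`|a t| <= (C * `|b t|)%R%:E)%E.

(* Main.v *)
Require Import Defs.
From HB Require Import structures.
From mathcomp Require Import all_boot all_order all_algebra.
From mathcomp Require Import finmap.
From mathcomp Require Import all_classical all_reals all_analysis.
From mathcomp Require Import measurable_realfun.
From mathcomp Require Import ring lra.

Set Implicit Arguments.
Unset Strict Implicit.
Unset Printing Implicit Defensive.

Import Order.TTheory GRing.Theory Num.Theory.
Import numFieldNormedType.Exports.

Local Open Scope classical_set_scope.
Local Open Scope ring_scope.

(* At a relative interior point x a continuous selection makes h
   differentiable along the affine hull of X, so the dual iterate y_t may replace
   gradh x_t in the Bregman divergence D_t = D(xs, x_t).  The three-point
   identity together with relative strong convexity and smoothness gives
     D_(t+1) <= (1 - gamma mu) D_t + gamma U(xs - x_t)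
                + gamma U(x_t - x_(t+1)) - (1 - gamma L) D(x_(t+1), x_t),
   and since X is bounded and gamma L <= 1/p < 1 the last two terms are
   O((gamma |U|)^p).  The first noise term has mean zero because x_t is a
   function of the seeds 1, ..., t-1, hence independent of the t-th one.
   The expectations a_t = E D_t therefore satisfy Chung's recursion
   a_(t+1) <= (1 - beta mu / t) a_t + C / t^p, and K/2 |x_t - xs|^2 <= D_t. *)

(** * Chung's recursion *)

(** The update produces the noise paired with [xs - x_(t+1)], and this pairing is not centred
    because [x_(t+1)] depends on seed t. Hence the split at [x_t]: only [xs - x_t] is fixed before
    that seed is drawn, and the remainder [x_t - x_(t+1)] is paid for pathwise by the negative
    quadratic term. The step-size condition keeps that term alive: [gamma L <= 1/p] leaves a factor
    of at least [1 - 1/p > 0] in front of [K/2 |x_(t+1) - x_t|^2]. With only a p-th moment the noise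
    may have infinite variance, so a bound by [|U|^2] is of no use; the boundedness of [X] lowers
    that exponent to p.

    The other obstacle is measurability: the iterates are given as points of an argmax, and the
    oracle is measurable only over [dom_subdiff h]. That set is Borel, being the relative interior
    of a compact set, and strong convexity makes each iterate a Lipschitz function of finitely many
    evaluations of its dual point. Adaptedness to the seeds then follows by induction on t. *)

Section real_lemmas.
Context {R : realType}.
Implicit Types (a : nat -> R) (b c p r : R) (t : nat).

Lemma powR_expR_ln (x r : R) : 0 < x -> x `^ r = expR (r * ln x).
Proof. by move=> x0; rewrite /powR gt_eqF. Qed.

Lemma gt0_powRD (x r r' : R) : 0 < x -> x `^ (r + r') = x `^ r * x `^ r'.
Proof. by move=> x0; rewrite powRD// (gt_eqF x0) implybT. Qed.

Lemma gt0_powRB (x r r' : R) : 0 < x -> x `^ (r - r') = x `^ r / x `^ r'.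
Proof. by move=> x0; rewrite gt0_powRD// powRN. Qed.

(** Both sides come from [ln (1 + x) <= x]: at [x = 1/t], and at [x = - 1/(t+1)], where the
    resulting [1/(t+1)] is weakened to [1/(2t)]. *)
Lemma ln_succ_bounds t : (0 < t)%N ->
  (2 * t%:R)^-1 <= ln (t.+1%:R : R) - ln t%:R <= t%:R^-1.
Proof.
move=> t0; have T0 : 0 < t%:R :> R by rewrite ltr0n.
have T1 : 1 <= t%:R :> R by rewrite ler1n.
have S0 : 0 < t.+1%:R :> R by rewrite ltr0n.
have SE : t.+1%:R = t%:R + 1 :> R by rewrite -addn1 natrD.
apply/andP; split.
  rewrite -ln_div ?posrE// -[leRHS]opprK -lnV ?posrE ?divr_gt0// invf_div.
  have -> : t%:R / t.+1%:R = 1 + - t.+1%:R^-1 :> R.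
    by rewrite SE; field; rewrite gt_eqF// -SE.
  rewrite lerNr; apply: le_trans (le_ln1Dx _) _.
    by rewrite ltrN2 invf_lt1// SE ltrDr.
  by rewrite lerN2 lef_pV2 ?posrE ?mulr_gt0// SE; lra.
rewrite -ln_div ?posrE// (_ : _ / _ = 1 + t%:R^-1); last first.
  by rewrite SE; field; rewrite gt_eqF.
by apply: le_ln1Dx; apply: lt_trans (_ : 0 < _); rewrite ?invr_gt0// oppr_lt0.
Qed.

Lemma powR_succ t r : (0 < t)%N ->
  t.+1%:R `^ r = t%:R `^ r * expR (r * (ln t.+1%:R - ln t%:R)) :> R.
Proof.
move=> t0; rewrite !powR_expR_ln ?ltr0n// -expRD; congr expR; ring.
Qed.

Lemma powR_succ_ge t r : (0 < t)%N -> 0 <= r ->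
  t%:R `^ (- r) * (1 - r / t%:R) <= t.+1%:R `^ (- r) :> R.
Proof.
move=> t0 r0; rewrite powR_succ// ler_wpM2l ?powR_ge0//.
apply: le_trans (expR_ge1Dx _); rewrite lerD2l mulNr lerN2 ler_wpM2l//.
by case/andP: (ln_succ_bounds t0).
Qed.

Lemma powR_succ_le t b : (0 < t)%N -> 0 <= b ->
  t.+1%:R `^ b * (1 - b / t%:R) <= t%:R `^ b :> R.
Proof.
move=> t0 b0; rewrite powR_succ// -mulrA ler_piMr ?powR_ge0//.
apply: (@le_trans _ _ (expR (b / t%:R) * expR (- (b / t%:R)))).
  apply: (@le_trans _ _ (expR (b * (ln t.+1%:R - ln t%:R)) * expR (- (b / t%:R)))).
    by rewrite ler_wpM2l ?expR_ge0//; exact: expR_ge1Dx.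
  rewrite ler_wpM2r ?expR_ge0// ler_expR ler_wpM2l//.
  by case/andP: (ln_succ_bounds t0).
by rewrite expRxMexpNx_1.
Qed.

(** Discrete form of the derivative of [- t^(-r)]. With [e = ln (t+1) - ln t] the drop is
    [t^(-r) (1 - expR (- r e))], at least [t^(-r) r e / (1 + r e)]; then [e >= 1/(2t)] and
    [r e <= r] give the constant. *)
Lemma powR_succ_decrement t r : (0 < t)%N -> 0 < r ->
  r / (2 * (1 + r)) * t%:R `^ (- r - 1) <=
  t%:R `^ (- r) - t.+1%:R `^ (- r) :> R.
Proof.
move=> t0 r0; have T0 : 0 < t%:R :> R by rewrite ltr0n.
have T1 : t%:R^-1 <= 1 :> R by rewrite invf_le1// ler1n.
have /andP[e1 e2] := ln_succ_bounds t0.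
rewrite powR_succ// mulrC [leRHS](_ : _ = t%:R `^ (- r) *
  (1 - expR (- r * (ln t.+1%:R - ln t%:R)))); last by ring.
rewrite gt0_powRD//.
rewrite -mulrA ler_wpM2l ?powR_ge0// powR_inv1 ?(ltW T0)//.
set e := ln _ - _ in e1 e2 *.
have e0 : 0 <= e by apply: le_trans e1; rewrite invr_ge0 mulr_ge0// ltW.
have re0 : 0 <= r * e by rewrite mulr_ge0// ltW.
have re1 : r * e <= r by rewrite ler_piMr// ?(ltW r0)//; exact: le_trans T1.
have h1 : expR (- r * e) <= (1 + r * e)^-1.
  rewrite mulNr expRN lef_pV2 ?posrE ?expR_gt0//; last by lra.
  exact: expR_ge1Dx.
have h2 : (1 + r * e)^-1 = 1 - r * e / (1 + r * e) by field; lra.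
have h3 : r / (2 * (1 + r)) / t%:R <= r * e / (1 + r * e).
  rewrite ler_pdivlMr; last lra.
  apply: (@le_trans _ _ (r * (2 * t%:R)^-1 * ((1 + r * e) / (1 + r)))).
    by rewrite le_eqVlt; apply/orP; left; apply/eqP; field; rewrite gt_eqF//; lra.
  apply: (@le_trans _ _ (r * (2 * t%:R)^-1 * 1)).
    rewrite ler_wpM2l ?mulr_ge0 ?invr_ge0 ?mulr_ge0 ?(ltW r0) ?(ltW T0)//.
    by rewrite ler_pdivrMr ?mul1r; lra.
  by rewrite mulr1 ler_wpM2l// ltW.
rewrite mulrC; lra.
Qed.

(** The profile [M t^(-(p-1))] dominates by induction: it loses at most a fraction [(p-1)/t] per
    step while the recursion contracts by [b/t], and the surplus [M (b - (p-1))] absorbs [C]. *)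
Lemma chung_case_lt a b C p : 1 < p -> 0 < b -> 0 <= C ->
  (forall t, (0 < t)%N -> a t.+1 <= (1 - b / t%:R) * a t + C / t%:R `^ p) ->
  p < 1 + b ->
  exists M, 0 <= M /\ \forall t \near \oo, a t <= M / t%:R `^ (p - 1).
Proof.
move=> p1 b0 C0 arec pb.
(* From [T0] on the factor [1 - b/t] is nonnegative, so the induction hypothesis may be multiplied
   by it. *)
pose T0 := (Num.bound b).+1; have T0b t : (T0 <= t)%N -> b <= t%:R.
  move=> T0t; apply: (@le_trans _ _ T0%:R); last by rewrite ler_nat.
  by apply/ltW/(lt_trans (archi_boundP (ltW b0))); rewrite ltr_nat.
pose M := Num.max (C / (b - (p - 1))) (a T0 * T0%:R `^ (p - 1)).
have CM : C / (b - (p - 1)) <= M by rewrite le_max lexx.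
have M0 : 0 <= M by apply: le_trans CM; rewrite divr_ge0//; lra.
exists M; split => //; exists T0 => // t /= T0t; rewrite -powRN.
rewrite -(subnKC T0t); elim: (t - T0)%N => [|k IH].
  rewrite addn0 powRN ler_pdivlMr ?powR_gt0 ?ltr0n//.
  by rewrite le_max lexx orbT.
rewrite addnS; set u := (T0 + k)%N in IH *.
have u0 : (0 < u)%N by rewrite /u /T0.
have U0 : 0 < u%:R :> R by rewrite ltr0n.
apply: (le_trans (arec _ u0)).
apply: (@le_trans _ _ (M * (u%:R `^ (- (p - 1)) * (1 - (p - 1) / u%:R)))); last first.
  by rewrite ler_wpM2l// powR_succ_ge//; lra.
have b1 : 0 <= 1 - b / u%:R.
  by rewrite subr_ge0 ler_pdivrMr// mul1r T0b// /u leq_addr.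
apply: (@le_trans _ _ ((1 - b / u%:R) * (M * u%:R `^ (- (p - 1))) + C / u%:R `^ p)).
  by rewrite lerD2r ler_wpM2l.
have -> : C / u%:R `^ p = u%:R `^ (- (p - 1)) * (C / u%:R).
  rewrite (_ : p = 1 + (p - 1)) in |- *; last by ring.
  rewrite (_ : 1 + _ - _ = p - 1); last by ring.
  rewrite gt0_powRD//.
  by rewrite powRr1 ?(ltW U0)// powRN invfM; ring.
rewrite -subr_ge0.
set Z := u%:R `^ _.
rewrite (_ : _ - _ = Z / u%:R * (M * (b - (p - 1)) - C)); last by ring.
rewrite mulr_ge0 ?divr_ge0 ?powR_ge0 ?(ltW U0)// subr_ge0 -ler_pdivrMr//; lra.
Qed.

(** Since [(t+1)^b (1 - b/t) <= t^b], the integrating factor [(t+1)^b] makes the recursion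
    telescope; nonnegativity of [a] covers the early steps where [1 - b/t] may be negative. The
    increments are of order [t^(b-p)], and [G] stands for a discrete antiderivative of that
    power. *)
Lemma chung_telescope a b C p (G : nat -> R) c :
  0 < b -> 0 <= C -> 0 < c -> (forall t, (0 < t)%N -> 0 <= a t) ->
  (forall t, (0 < t)%N -> a t.+1 <= (1 - b / t%:R) * a t + C / t%:R `^ p) ->
  (forall t, (0 < t)%N -> c * t%:R `^ (b - p) <= G t.+1 - G t) ->
  exists2 B, 0 <= B &
    forall t, (0 < t)%N -> a t * t%:R `^ b <= a 1%N + B * (G t - G 1%N).
Proof.
move=> b0 C0 c0 a0 arec HG; exists (C * 2 `^ b / c).
  by rewrite divr_ge0 ?mulr_ge0 ?powR_ge0// ltW.
elim=> // -[_ _|t IH _].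
  by rewrite powR1 mulr1 subrr mulr0 addr0.
set u := t.+1 in IH *; have u0 : (0 < u)%N by [].
have U0 : 0 < u%:R :> R by rewrite ltr0n.
apply: (@le_trans _ _ (a u * u%:R `^ b + C * 2 `^ b * u%:R `^ (b - p))); last first.
  have := IH isT; have := HG _ u0; move: (G u.+1) (G u) => x y h1 h2.
  have h3 : C * 2 `^ b * u%:R `^ (b - p) <= C * 2 `^ b / c * (x - y).
    rewrite -!mulrA !ler_wpM2l ?powR_ge0// ler_pdivlMl//.
  by rewrite (_ : x - G 1%N = (y - G 1%N) + (x - y)) ?mulrDr; [lra|ring].
apply: (@le_trans _ _ (((1 - b / u%:R) * a u + C / u%:R `^ p) * u.+1%:R `^ b)).
  by rewrite ler_wpM2r ?powR_ge0// arec.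
rewrite mulrDl lerD//.
  rewrite mulrAC mulrC ler_wpM2l ?a0//= mulrC; apply: powR_succ_le => //; exact: ltW.
rewrite gt0_powRB//.
(* [u + 1 <= 2 u] is the source of the factor [2^b] in the constant. *)
have h : u.+1%:R `^ b <= 2 `^ b * u%:R `^ b :> R.
  rewrite -powRM ?ler0n// ge0_ler_powR ?nnegrE ?mulr_ge0 ?ler0n ?(ltW b0)//.
  by rewrite -natrM ler_nat mul2n -addnn -addn1 leq_add2l.
by rewrite -!mulrA ler_wpM2l// mulrC mulrA ler_wpM2r// invr_ge0 powR_ge0.
Qed.

Lemma chung_case_eq a b C p : 0 < b -> 0 <= C -> (forall t, (0 < t)%N -> 0 <= a t) ->
  (forall t, (0 < t)%N -> a t.+1 <= (1 - b / t%:R) * a t + C / t%:R `^ p) ->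
  p = 1 + b ->
  exists M, 0 <= M /\ \forall t \near \oo, a t <= M * (ln t%:R / t%:R `^ (p - 1)).
Proof.
move=> b0 C0 a0 arec pb.
have c0 : 0 < 2^-1 :> R by lra.
have [t t0|B B0 HB] := @chung_telescope a b C p (fun t => ln t%:R) _ b0 C0 c0 a0 arec.
  have /andP[+ _] := ln_succ_bounds t0.
  rewrite (_ : b - p = -1); last by rewrite pb; ring.
  by rewrite powR_inv1 ?ler0n// invfM.
have l2 : 0 < ln 2 :> R by rewrite ln_gt0// ltr1n.
(* For [t >= 2] one has [a 1 <= (a 1 / ln 2) ln t], which merges the initial value into the
   logarithm. *)
exists (a 1%N / ln 2 + B); split; first by rewrite addr_ge0// divr_ge0 ?a0// ltW.
exists 2%N => // t /= t2; have t0 : (0 < t)%N by apply: leq_trans t2.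
have -> : p - 1 = b by rewrite pb; ring.
rewrite mulrA ler_pdivlMr ?powR_gt0 ?ltr0n//; apply: (le_trans (HB _ t0)).
rewrite ln1 subr0 mulrDl lerD2r mulrAC ler_pdivlMr//.
apply: ler_wpM2l; first exact: a0.
by rewrite ler_ln ?posrE ?ltr0n// ler_nat.
Qed.

Lemma chung_case_gt a b C p : 0 < b -> 0 <= C -> (forall t, (0 < t)%N -> 0 <= a t) ->
  (forall t, (0 < t)%N -> a t.+1 <= (1 - b / t%:R) * a t + C / t%:R `^ p) ->
  p > 1 + b ->
  exists M, 0 <= M /\ \forall t \near \oo, a t <= M / t%:R `^ b.
Proof.
move=> b0 C0 a0 arec pb; pose r := p - 1 - b; have r0 : 0 < r by rewrite /r; lra.
have c0 : 0 < r / (2 * (1 + r)) by rewrite divr_gt0//; lra.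
(* Here [b - p = - r - 1 < -1], so the increments are summable: this [G] stays between -1 and 0 for
   [t >= 1]. *)
have [t t0|B B0 HB] := @chung_telescope a b C p (fun t => - t%:R `^ (- r)) _
  b0 C0 c0 a0 arec.
  rewrite (_ : b - p = - r - 1); last by rewrite /r; ring.
  by apply: le_trans (powR_succ_decrement t0 r0) _; rewrite opprK addrC.
exists (a 1%N + B); split; first by rewrite addr_ge0 ?a0.
exists 1%N => // t /= t0; rewrite ler_pdivlMr ?powR_gt0 ?ltr0n//.
apply: (le_trans (HB _ t0)); rewrite lerD2l ler_piMr// powR1 opprK.
by rewrite gerDr oppr_le0 powR_ge0.
Qed.

(* A substitute for Young's inequality that keeps the exponent 2 of [s] by
   trading the surplus against the bound [s <= D]. *)
Lemma young_bounded (p c D s z : R) : 1 < p <= 2 -> 0 < c -> 0 < D ->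
  0 <= s <= D -> 0 <= z ->
  z * s - c * s ^+ 2 <= D `^ (2 - p) / c `^ (p - 1) * z `^ p.
Proof.
move=> /andP[p1 p2] c0 D0 /andP[s0 sD] z0.
have rhs0 : 0 <= D `^ (2 - p) / c `^ (p - 1) * z `^ p.
  by rewrite mulr_ge0 ?divr_ge0 ?powR_ge0.
have [zs|zs] := leP (z * s) (c * s ^+ 2); first by apply: le_trans rhs0; lra.
apply: (@le_trans _ _ (z * s)); first by rewrite gerBl mulr_ge0 ?sqr_ge0 ?ltW.
have sp : 0 < s.
  by rewrite lt_neqAle s0 andbT; apply/eqP => s0'; move: zs; rewrite -s0' expr0n/= !mulr0 ltxx.
have zc : s <= z / c.
  rewrite ler_pdivlMr//; apply/ltW; move: zs.
  by rewrite expr2 mulrA -subr_gt0 -mulrBl pmulr_lgt0// subr_gt0 mulrC.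
(* Now [s <= z / c]. One factor of [s] is compared with [D], the other with [z / c]; both exponents
   are nonnegative and they add up to 1. *)
have -> : s = s `^ (2 - p) * s `^ (p - 1).
  by rewrite -gt0_powRD// (_ : 2 - p + _ = 1) ?powRr1//; ring.
rewrite -(mulr_powRB1 z0); last by lra.
rewrite mulrCA -!mulrA; apply: ler_pM; rewrite ?mulr_ge0 ?powR_ge0//.
  by apply: ge0_ler_powR; rewrite ?nnegrE ?(ltW D0)//; lra.
rewrite mulrCA ler_wpM2l//.
have : s `^ (p - 1) <= (z / c) `^ (p - 1).
  by apply: ge0_ler_powR; rewrite ?nnegrE ?divr_ge0 ?(ltW c0)//; lra.
rewrite powRM// ?invr_ge0 ?(ltW c0)// -powR_inv1 ?(ltW c0)// powRAC -powRN mulrC.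
by rewrite -powRrM mulrN1.
Qed.

End real_lemmas.

(** * Finite-dimensional normed spaces *)

Lemma ler_coord_norm (R : realType) n (u : 'rV[R]_n) i : `|u 0 i| <= `|u|.
Proof.
rewrite [leRHS]/Num.norm /= mx_normrE.
by apply: le_trans (le_bigmax _ _ (0, i)).
Qed.

(** A spanning family whose coordinates are bounded by the norm: norm equivalence in the form that
    lets finitely many real evaluations control a functional. *)
Record coord_frame (R : realType) (V : normedModType R) (n : nat) := CoordFrame {
  frame_vec : 'I_n -> V;
  frame_coord : 'I_n -> V -> R;
  frame_bound : R;
  frame_bound_gt0 : 0 < frame_bound;
  frame_decomp : forall v, v = \sum_i frame_coord i v *: frame_vec i;
  frame_coordB : forall i u v,
    frame_coord i (u - v) = frame_coord i u - frame_coord i v;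
  frame_coord_le : forall i v, `|frame_coord i v| <= frame_bound * `|v| }.

Lemma coord_frame_exists (R : realType) (V : normedModType R) n :
  Vector.axiom n V -> inhabited (coord_frame V n).
Proof.
move=> [v2r v2r_lin [r2v v2rK r2vK]].
have r2v_lin a u w : r2v (a *: u + w) = a *: r2v u + r2v w.
  by apply: (can_inj v2rK); rewrite v2r_lin !r2vK.
have r2v0 : r2v 0 = 0 by have := r2v_lin (-1) 0 0; rewrite scaler0 addr0 scaleN1r addNr.
have r2vD u w : r2v (u + w) = r2v u + r2v w.
  by have := r2v_lin 1 u w; rewrite !scale1r.
have r2vZ a u : r2v (a *: u) = a *: r2v u.
  by have := r2v_lin a u 0; rewrite !addr0 r2v0 addr0.
pose e i : V := r2v (delta_mx 0 i).
have r2vE u : r2v u = \sum_i u 0 i *: e i.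
  rewrite [in LHS](row_sum_delta u) (big_morph r2v r2vD r2v0).
  by apply: eq_bigr => i _; rewrite r2vZ.
pose S := [set u : 'rV[R]_n | `|u| = 1].
have Ncont : continuous (fun u : 'rV[R]_n => `|r2v u|).
  have r2vcont : continuous r2v.
    rewrite (funext r2vE : r2v = _) => u.
    have FF : Filter (nbhs u) by exact: nbhs_filter.
    apply: cvg_big => [|i _]; first exact: add_continuous.
    by apply: cvgZr_tmp; exact: coord_continuous.
  by move=> u; apply: continuous_comp; [exact: r2vcont|exact: norm_continuous].
have Scompact : compact S.
  apply: bounded_closed_compact.
    exists 1; split => // M M1 u; rewrite /S /= => ->; exact: ltW.
  have -> : S = (fun u : 'rV[R]_n => `|u|) @^-1` [set 1] by [].
  by apply: preimage_closed => [u _|]; [exact: norm_continuous|exact: closed_eq].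
(* The norm attains its minimum on the compact sphere, and injectivity of [r2v] makes that minimum
   positive. For [n = 0] the sphere is empty and any constant serves. *)
have [m m0 Hm] : exists2 m, 0 < m & forall u, S u -> m <= `|r2v u|.
  have [Sne|S0] := pselect (S !=set0); last first.
    by exists 1 => // u Su; exfalso; apply: S0; exists u.
  have [|u0] := @compact_EVT_min _ _ (fun u => `|r2v u|) S Sne Scompact.
    exact: continuous_subspaceT.
  rewrite inE => Su0 Hu0; exists `|r2v u0|; last first.
    by move=> u Su; apply: Hu0; rewrite inE.
  rewrite normr_gt0; apply/eqP => r0.
  have : u0 = 0 by apply: (can_inj r2vK); rewrite r0 r2v0.
  by move=> u00; move: Su0; rewrite /S /= u00 normr0 => /eqP; rewrite eq_sym oner_eq0.
have Hbd u : `|u| <= m^-1 * `|r2v u|.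
  have [->|u0] := eqVneq u 0; first by rewrite normr0 mulr_ge0// invr_ge0 ltW.
  have nu : 0 < `|u| by rewrite normr_gt0.
  have /Hm : S (`|u|^-1 *: u).
    by rewrite /S /= normrZ normfV normr_id mulVf// gt_eqF.
  rewrite r2vZ normrZ normfV normr_id ler_pdivlMl// => um.
  by rewrite ler_pdivlMl// mulrC.
constructor; apply: (@CoordFrame _ _ _ e (fun i v => v2r v 0 i) m^-1).
- by rewrite invr_gt0.
- by move=> v; rewrite -r2vE v2rK.
- move=> i u v; rewrite -[in LHS]scaleN1r [in LHS]addrC v2r_lin !mxE.
  by rewrite mulN1r addrC.
- move=> i v; apply: le_trans (ler_coord_norm _ _) _.
  by rewrite -[in leRHS](v2rK v) Hbd.
Qed.

Section frame_theory.
Context {R : realType} {V : normedModType R} {n : nat} (F : coord_frame V n).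
Local Notation e := (frame_vec F).
Local Notation c := (frame_coord F).

Definition frame_norm (phi : V -> R) : R := \sum_i `|phi (e i)|.

Lemma frame_norm_ge0 phi : 0 <= frame_norm phi.
Proof. exact: sumr_ge0. Qed.

Lemma linear_frame (phi : {linear V -> R^o}) v :
  phi v = \sum_i c i v * phi (e i).
Proof.
by rewrite [in LHS](frame_decomp F v) linear_sum; apply: eq_bigr => i _; rewrite linearZ.
Qed.

Lemma frame_norm_bound (phi : {linear V -> R^o}) v :
  `|phi v| <= frame_bound F * frame_norm phi * `|v|.
Proof.
rewrite linear_frame (le_trans (ler_norm_sum _ _ _))//.
rewrite mulrAC mulr_sumr ler_sum// => i _; rewrite normrM ler_wpM2r//.
exact: frame_coord_le.
Qed.

(** [dual_norm] is a real [sup], informative only on a bounded set. Linearity is all that the type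
    of [phi] records, so boundedness on the unit ball is taken from the frame. *)
Lemma dual_norm_bound (phi : {linear V -> R^o}) v :
  `|phi v| <= dual_norm phi * `|v|.
Proof.
have ub u : `|u| <= 1 -> phi u <= dual_norm phi.
  move=> u1; apply: ub_le_sup; last by exists u.
  exists (frame_bound F * frame_norm phi) => _ [w /= w1 <-].
  apply: le_trans (ler_norm _) _; apply: le_trans (frame_norm_bound _ _) _.
  by rewrite ler_piMr// mulr_ge0 ?frame_norm_ge0// ltW// frame_bound_gt0.
have [->|v0] := eqVneq v 0; first by rewrite linear0 !normr0 mulr0.
have nv : 0 < `|v| by rewrite normr_gt0.
have N1 : `| `|v|^-1 *: v| <= 1.
  by rewrite normrZ normfV normr_id mulVf// gt_eqF.
rewrite -ler_pdivrMr//.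
have phiZ : phi (`|v|^-1 *: v) = phi v / `|v| by rewrite linearZ mulrC.
have /= := ub (`|v|^-1 *: v) N1; have /= := ub (- (`|v|^-1 *: v)).
rewrite normrN N1 linearN phiZ => /(_ isT).
have [pv|pv] := ger0P (phi v) => h1 h2; last by rewrite mulNr.
by [].
Qed.

Lemma dual_norm_boundB (phi psi : {linear V -> R^o}) v :
  `|phi v - psi v| <= dual_norm (phi \- psi) * `|v|.
Proof. exact: (dual_norm_bound (phi \- psi)). Qed.

Lemma dual_norm_ge0 (phi : {linear V -> R^o}) : 0 <= dual_norm phi.
Proof.
apply: ub_le_sup; last by exists 0; rewrite /= ?normr0 ?linear0.
exists (frame_bound F * frame_norm phi) => _ [w /= w1 <-].
apply: le_trans (ler_norm _) _; apply: le_trans (frame_norm_bound _ _) _.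
by rewrite ler_piMr// mulr_ge0 ?frame_norm_ge0// ltW// frame_bound_gt0.
Qed.

Lemma frame_norm_le_dual (phi : {linear V -> R^o}) :
  frame_norm phi <= (1 + \sum_i `|e i|) * dual_norm phi.
Proof.
rewrite mulrDl mul1r mulr_suml ler_wpDl ?dual_norm_ge0// ler_sum// => i _.
by rewrite mulrC; exact: dual_norm_bound.
Qed.

End frame_theory.

(** * One step of mirror descent *)

Section mirror_descent.
Context {R : realType} {V : normedModType R} {n : nat} (F : coord_frame V n).
Context (X : set V) (h : V -> \bar R) (gradh : V -> {linear V -> R^o}).
Hypotheses (hconvex : econvex h) (hdom : edom h = X).
Hypothesis gradhP : continuous_selection h gradh.
Hypothesis hsteep : steep X h.
Context (K : R).
Hypothesis K0 : 0 < K.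
Hypothesis hstrong : forall x x', dom_subdiff h x -> X x' ->
  (h x + (gradh x (x' - x)%R)%:E + (K / 2 * `|x' - x| ^+ 2)%R%:E <= h x')%E.
Implicit Types (x z v : V) (y : {linear V -> R^o}).

Lemma selection_cvg (f : V -> \bar R) (g : V -> {linear V -> R^o}) x v :
  continuous_selection f g -> dom_subdiff f x ->
  g x' v @[x' --> within (dom_subdiff f) (nbhs x)] --> g x v.
Proof.
move=> gP /gP[_ gx]; apply/cvgrPdist_le => e e0.
have v1 : 0 < `|v| + 1 by rewrite ltr_wpDl.
have := gx => /cvgrPdist_le /(_ (e / (`|v| + 1))).
rewrite divr_gt0// => /(_ isT); apply: filterS => z.
rewrite sub0r normrN => hz; rewrite distrC.
apply: le_trans (dual_norm_boundB F _ _ _) _.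
apply: (@le_trans _ _ (e / (`|v| + 1) * (`|v| + 1))); last by rewrite divfK// gt_eqF.
apply: (@le_trans _ _ (`|dual_norm (g z \- g x)| * `|v|)).
  by rewrite ler_wpM2r// ler_norm.
by apply: ler_pM => //; rewrite lerDl.
Qed.

Lemma fin_num_dom x : X x -> h x \is a fin_num.
Proof.
rewrite -hdom /edom/= => hx; rewrite fin_numE; apply/andP; split.
  exact: hconvex.1.
by rewrite lt_eqF.
Qed.

Lemma infty_off_dom x : ~ X x -> h x = +oo%E.
Proof.
by rewrite -hdom /edom/= => /negP; rewrite -leNgt leye_eq => /eqP.
Qed.

Lemma dom_subdiff_sub x : dom_subdiff h x -> X x.
Proof. by rewrite hsteep => -[]. Qed.

Lemma affine_hull_line x z (t : R) :
  X x -> X z -> affine_hull X (x + t *: (z - x)).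
Proof.
move=> Xx Xz A [Aaff XA].
have -> : x + t *: (z - x) = t *: z + (1 - t) *: x.
  by rewrite scalerBr scalerBl scale1r addrCA.
by apply: Aaff; apply: XA.
Qed.

Lemma subdiff_fine x y z : X x -> X z -> subdiff h x y ->
  fine (h x) + y (z - x) <= fine (h z).
Proof.
move=> /fin_num_dom hx /fin_num_dom hz /(_ z).
by rewrite -(fineK hx) -(fineK hz) -EFinD lee_fin.
Qed.

Lemma cvg_line (x v : V) : x + t *: v @[t --> 0^'+] --> x.
Proof.
apply: cvg_at_right_filter; rewrite -[X in _ --> X]addr0 -(scale0r v).
by apply: cvgD; [exact: cvg_cst|apply: cvgZr_tmp; exact: cvg_id].
Qed.

Lemma relint_line x v : dom_subdiff h x ->
  (forall t : R, affine_hull X (x + t *: v)) ->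
  \forall t \near 0^'+, dom_subdiff h (x + t *: v).
Proof.
rewrite hsteep => -[Xx xX] xv.
have H := cvg_line v (nbhs_interior xX).
near=> t; have zX : \forall z \near x + t *: v, affine_hull X z -> X z by near: t.
by split => //; exact: (nbhs_singleton zX).
Unshelve. all: by end_near. Qed.

(** By steepness [x] lies in the relative interior, so [x + t v] stays in [dom_subdiff h] for small
    [t > 0]. Adding the subgradient inequalities at [x] and [x + t v] cancels the values of [h] and
    leaves [y v <= gradh (x + t v) v]; continuity of the selection concludes as [t] tends to 0. *)
Lemma subgradient_le x y v : dom_subdiff h x -> subdiff h x y ->
  (forall t : R, affine_hull X (x + t *: v)) -> y v <= gradh x v.
Proof.
move=> hx xy xv; apply/ler_addgt0Pr => e e0.
have cvgx : x + t *: v @[t --> 0^'+] --> within (dom_subdiff h) (nbhs x).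
  move=> A /(cvg_line v); move=> xA.
  have {}xA : \forall t \near 0^'+, dom_subdiff h (x + t *: v) -> A (x + t *: v).
    exact: xA.
  have Dx := relint_line hx xv.
  suff : \forall t \near 0^'+, A (x + t *: v) by [].
  near=> t.
  have /= : dom_subdiff h (x + t *: v) -> A (x + t *: v) by near: t.
  by apply; near: t.
have := selection_cvg (v := v) gradhP hx => /cvgrPdist_le /(_ _ e0) /cvgx H.
have [t [[/= t0 xt] et]] : exists t : R, (0 < t /\ dom_subdiff h (x + t *: v)) /\
    `|gradh x v - gradh (x + t *: v) v| <= e.
  apply: (@filter_ex _ (0^'+)); near=> t; split; last by near: t.
  by split; near: t; [exact: nbhs_right_gt|exact: relint_line].
have h1 := subdiff_fine (dom_subdiff_sub hx) (dom_subdiff_sub xt) xy.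
have h2 := subdiff_fine (dom_subdiff_sub xt) (dom_subdiff_sub hx) (gradhP xt).1.
rewrite opprD addrA subrr add0r linearN linearZ/= in h2.
rewrite addrAC subrr add0r linearZ/= in h1.
have : t * (y v - gradh (x + t *: v) v) <= 0.
  move: h1 h2; rewrite /GRing.scale/=; lra.
rewrite pmulr_rle0// subr_le0 => /le_trans; apply.
by move: et; rewrite ler_distl => /andP[]; lra.
Unshelve. all: by end_near. Qed.

(* Monotonicity of the subdifferential along both directions of a segment
   squeezes [y] onto the limit of the selection. *)
Lemma subgradient_eq x y z : subdiff h x y -> X z -> y (z - x) = gradh x (z - x).
Proof.
move=> xy Xz; have hx : dom_subdiff h x by exists y.
have Xx := dom_subdiff_sub hx.
apply/eqP; rewrite eq_le; apply/andP; split.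
  by apply: subgradient_le => // t; exact: affine_hull_line.
rewrite -lerN2 -!linearN; apply: subgradient_le => // t.
by rewrite scalerN -scaleNr; exact: affine_hull_line.
Qed.

Lemma mirror_map_subdiff x y : mirror_map X h y x -> subdiff h x y.
Proof.
move=> [Xx xmax] z; have [Xz|Xz] := pselect (X z); last first.
  by rewrite (infty_off_dom Xz) leey.
have := xmax _ Xz.
rewrite -(fineK (fin_num_dom Xx)) -(fineK (fin_num_dom Xz)) -!EFinB -EFinD !lee_fin.
rewrite linearB/=; lra.
Qed.

(* The Bregman divergence from [x] with the dual point [y] in place of
   [gradh x], see [fenchel_bregman]. *)
Definition fenchel z x y : R := fine (h z) - fine (h x) - y (z - x).

Lemma fenchel_bregman z x y : X z -> subdiff h x y ->
  bregman h gradh z x = (fenchel z x y)%:E.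
Proof.
move=> Xz xy; have Xx : X x by apply: dom_subdiff_sub; exists y.
rewrite /bregman /fenchel (subgradient_eq xy Xz).
by rewrite !EFinB !fineK ?fin_num_dom.
Qed.

Lemma fenchel_ge z x y : X z -> subdiff h x y ->
  K / 2 * `|z - x| ^+ 2 <= fenchel z x y.
Proof.
move=> Xz xy; have hx : dom_subdiff h x by exists y.
have Xx := dom_subdiff_sub hx.
have := hstrong hx Xz; rewrite -(subgradient_eq xy Xz).
rewrite -(fineK (fin_num_dom Xx)) -(fineK (fin_num_dom Xz)) -!EFinD lee_fin.
rewrite /fenchel; lra.
Qed.

Lemma fenchel_ge0 z x y : X z -> subdiff h x y -> 0 <= fenchel z x y.
Proof.
move=> Xz xy; apply: le_trans (fenchel_ge Xz xy).
by rewrite mulr_ge0 ?sqr_ge0// divr_ge0// ltW.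
Qed.

(** Adding the strong convexity bounds in both directions gives [K |x' - x|^2 <= (y' - y) (x' - x)].
    The right-hand side is phrased with the evaluations on the frame because those are the
    real-valued functions through which the iterates are shown measurable. *)
Lemma mirror_map_lipschitz x x' y y' : subdiff h x y -> subdiff h x' y' ->
  K * `|x' - x| <= frame_bound F * \sum_i `|y' (frame_vec F i) - y (frame_vec F i)|.
Proof.
move=> xy xy'.
have Xx : X x by apply: dom_subdiff_sub; exists y.
have Xx' : X x' by apply: dom_subdiff_sub; exists y'.
have := lerD (fenchel_ge Xx' xy) (fenchel_ge Xx xy').
have := frame_norm_bound F (y' \- y) (x' - x); rewrite /frame_norm /=.
set s := \sum_i _ => h1.
rewrite /fenchel (distrC x x').
have -> : y' (x - x') = - y' (x' - x) by rewrite -linearN opprB.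
set r := `|x' - x| in h1 *; move=> h2.
have [r0|r0] := eqVneq r 0.
  by rewrite r0 mulr0 mulr_ge0 ?(ltW (frame_bound_gt0 F))// sumr_ge0.
have r1 : 0 < r by rewrite lt_neqAle eq_sym r0 /r normr_ge0.
rewrite -(ler_pM2r r1); apply: le_trans h1; apply: le_trans (ler_norm _).
move: h2; rewrite expr2; lra.
Qed.

(** The pairing of [gradf x] with [xs - x'] is split at [x]: strong convexity handles the part
    towards [xs], smoothness the part towards [x'], and [f xs <= f x'] removes the function values.
    Smoothness costs [gamma L D(x', x)], which is charged to the term [- D(x', x)] of the
    three-point identity. *)
Lemma mirror_step (f : V -> \bar R) (gradf : V -> {linear V -> R^o}) (mu L gamma : R)
    (xs x x' : V) (y y' : {linear V -> R^o}) (u : {linear V -> R^o}) :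
  (forall x, X x -> f x \is a fin_num) ->
  rel_strongly_convex X f h gradf gradh mu ->
  rel_smooth X f h gradf gradh L ->
  minimizer_over X f xs ->
  0 <= gamma -> gamma * L <= 1 ->
  subdiff h x y -> subdiff h x' y' ->
  (forall v, y' v = y v - gamma * (gradf x v + u v)) ->
  fenchel xs x' y' <= (1 - gamma * mu) * fenchel xs x y + gamma * u (xs - x) +
    (gamma * u (x - x') - (1 - gamma * L) * (K / 2) * `|x' - x| ^+ 2).
Proof.
move=> ffin fstrong fsmooth [Xxs xsmin] g0 gL xy xy' yE.
have hx : dom_subdiff h x by exists y.
have Xx := dom_subdiff_sub hx.
have Xx' : X x' by apply: dom_subdiff_sub; exists y'.
have sc : fine (f x) + gradf x (xs - x) + mu * fenchel xs x y <= fine (f xs).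
  have := fstrong _ _ hx Xxs; rewrite (fenchel_bregman Xxs xy).
  by rewrite -(fineK (ffin _ Xx)) -(fineK (ffin _ Xxs)) -EFinM -!EFinD lee_fin.
have sm : fine (f x') <= fine (f x) + gradf x (x' - x) + L * fenchel x' x y.
  have := fsmooth _ _ hx Xx'; rewrite (fenchel_bregman Xx' xy).
  by rewrite -(fineK (ffin _ Xx)) -(fineK (ffin _ Xx')) -EFinM -!EFinD lee_fin.
have mn : fine (f xs) <= fine (f x').
  by have := xsmin _ Xx'; rewrite -(fineK (ffin _ Xxs)) -(fineK (ffin _ Xx')) lee_fin.
have brx' := fenchel_ge Xx' xy.
have := ler_wpM2l (_ : 0 <= 1 - gamma * L) brx'; rewrite subr_ge0 => /(_ gL) {}brx'.
have := ler_wpM2l g0 sc; have := ler_wpM2l g0 sm; have := ler_wpM2l g0 mn.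
move: brx'; rewrite /fenchel yE !linearB/=; lra.
Qed.

End mirror_descent.

(** * Measurability and independence *)

(* No measurability is required: the integral of a nonnegative function is a
   supremum over the simple functions below it. *)
Lemma ge0_le_integralT d (T : measurableType d) (R : realType)
    (mu : {measure set T -> \bar R}) (f g : T -> \bar R) :
  (forall x, 0 <= f x)%E -> (forall x, f x <= g x)%E ->
  (\int[mu]_x f x <= \int[mu]_x g x)%E.
Proof.
move=> f0 fg; have g0 x : (0 <= g x)%E by exact: le_trans (fg x).
rewrite !ge0_integralTE//; apply: le_ereal_sup => _ [s sf <-].
by exists s => // x; exact: le_trans (sf x) (fg x).
Qed.

Section borel_measurability.
Context {R : realType} {V : normedModType R}.

Lemma open_measurable_borel (O : set V) : open O -> measurable (O : set (borel V)).
Proof. by move=> oO; exact: sub_sigma_algebra. Qed.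

Lemma relint_measurable (X : set V) : compact X ->
  measurable (relint X : set (borel V)).
Proof.
move=> cX.
have -> : relint X = X `&` interior [set z | affine_hull X z -> X z] by [].
apply: measurableI; last by apply: open_measurable_borel; exact: open_interior.
rewrite -[X]setCK; apply: measurableC; apply: open_measurable_borel.
rewrite openC; apply: compact_closed => //; exact: norm_hausdorff.
Qed.

Lemma within_cvg_measurable (D : set V) (g : V -> R) :
  (forall x, D x -> g x' @[x' --> within D (nbhs x)] --> g x) ->
  measurable_fun (D : set (borel V)) (g : borel V -> R).
Proof.
move=> gc mD; apply: (measurability _ (RGenOInfty.measurableE R)) => //.
move=> _ [_ [r ->] <-].
(* Relative continuity makes the implication hold in a full neighbourhood of each such point, so the
   preimage is [D] cut by an open set. *)
have -> : D `&` g @^-1` `]r, +oo[%classic =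
    D `&` interior [set z | D z -> r < g z].
  apply/seteqP; split => x /= [Dx].
    rewrite in_itv/= andbT => rx; split => //.
    by have := gc _ Dx => /cvgr_gt /(_ _ rx).
  by move=> /interior_subset /(_ Dx) rx; split => //; rewrite in_itv/= rx.
apply: measurableI => //; apply: open_measurable_borel; exact: open_interior.
Qed.

(** The preimage of an open set is a countable union of boxes in the real coordinates [c i]: the
    Lipschitz bound says that a small enough box around a point is mapped close to its image. *)
Lemma measurable_fun_of_coords d (T : measurableType d) n
    (c : 'I_n -> T -> R) (g : T -> V) (A : R) :
  (forall i, measurable_fun setT (c i)) -> 0 <= A ->
  (forall w w', `|g w' - g w| <= A * \sum_i `|c i w' - c i w|) ->
  measurable_fun setT (g : T -> borel V).
Proof.
move=> mc A0 gc; apply: (@measurability _ _ T (borel V) setT g (@open V)) => //.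
move=> _ [W oW <-]; rewrite setTI.
(* Boxes with rational centre and radius; [B'] empties those that leave the preimage, so that the
   union still runs over a countable type. *)
pose B (q : {ffun 'I_n -> rat} * rat) :=
  \bigcap_(i in [set: 'I_n]) (c i @^-1` `]ratr (q.1 i) - ratr q.2, ratr (q.1 i) + ratr q.2[%classic).
pose B' q := if `[< B q `<=` g @^-1` W >] then B q else set0.
have -> : g @^-1` W = \bigcup_q B' q.
  apply/seteqP; split => [w gw|w [q _]]; last first.
    by rewrite /B'; case: asboolP => // + Bw; apply.
  have /nbhs_ballP[e /= e0 eO] := open_nbhs_nbhs (conj oW gw).
  (* [A + 1] and [n.+1] keep this positive when [A] or [n] is 0; the 2 is there because two points
     of a box may differ by up to [2 r] in each coordinate. *)
  have den0 : 0 < 2 * (A + 1) * n.+1%:R.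
    by rewrite !mulr_gt0// ltr_wpDl.
  have [r /andP[r0 re]] : exists r : rat, 0 < (ratr r : R) < e / (2 * (A + 1) * n.+1%:R).
    by have [r] := rat_in_itvoo (divr_gt0 e0 den0); rewrite in_itv/=; exists r.
  have /choice[q hq] : forall i, exists q : rat,
      c i w - ratr r < (ratr q : R) < c i w + ratr r.
    move=> i; have [|q] := @rat_in_itvoo R (c i w - ratr r) (c i w + ratr r).
      by rewrite ltrD2l; lra.
    by rewrite in_itv/=; exists q.
  have Bw : B ([ffun i => q i], r) w.
    move=> i _; rewrite /= in_itv/= ffunE; have := hq i; lra.
  exists ([ffun i => q i], r) => //; rewrite /B' asboolT// => w' Bw'.
  apply: eO; rewrite -ball_normE /= distrC.
  apply: le_lt_trans (gc w w') _.
  apply: (@le_lt_trans _ _ (A * \sum_(i < n) (2 * ratr r))).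
    rewrite ler_wpM2l// ler_sum// => i _.
    have := Bw' i Logic.I; have := Bw i Logic.I; rewrite /= !in_itv/= ffunE => h1 h2.
    by rewrite ler_norml; lra.
  rewrite sumr_const card_ord -[_ *+ n]mulr_natl.
  apply: (@le_lt_trans _ _ ((A + 1) * (n.+1%:R * (2 * ratr r)))).
    have r2 : 0 <= 2 * ratr r :> R by rewrite mulr_ge0// ltW.
    have nr : n%:R * (2 * ratr r) <= n.+1%:R * (2 * ratr r) :> R.
      by rewrite ler_wpM2r// ler_nat.
    by apply: ler_pM => //; [rewrite mulr_ge0|rewrite lerDl].
  by move: re; rewrite ltr_pdivlMr//; lra.
apply: countable_bigcupT_measurable => // q.
rewrite /B'; case: ifP => // _; apply: fin_bigcap_measurable => // i _.
by rewrite -[X in measurable X]setTI; apply: mc => //; exact: measurable_itv.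
Qed.

Lemma frame_coord_measurable n (F : coord_frame V n) i (xs : V) :
  measurable_fun setT (fun z : borel V => frame_coord F i (xs - z) : R).
Proof.
apply: within_cvg_measurable => z _; apply/cvgrPdist_le => e e0.
apply: cvg_within; near=> z'.
rewrite !frame_coordB opprB addrC addrA subrK -frame_coordB.
apply: le_trans (frame_coord_le _ _ _) _.
rewrite -ler_pdivlMl ?frame_bound_gt0// distrC; near: z'.
by apply: cvgr_dist_le => //; rewrite mulr_gt0// invr_gt0 frame_bound_gt0.
Unshelve. all: by end_near. Qed.

End borel_measurability.

(** * Integrals over an independent pair *)

Section joint_law.
Context {R : realType} d d1 d2 (T : measurableType d) (Z : measurableType d1)
  (S : measurableType d2) (P : probability T R) (nu : probability S R).
Context (X : T -> Z) (s : T -> S).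
Hypotheses (mX : measurable_fun setT X) (ms : measurable_fun setT s).
Hypothesis indep : forall A B, measurable A -> measurable B ->
  (P (X @^-1` A `&` s @^-1` B) = P (X @^-1` A) * nu B)%E.

Let X' : {mfun T >-> Z} := HB.pack X (isMeasurableFun.Build _ _ _ _ _ mX).
Let mXs : measurable_fun setT (fun w => (X w, s w)).
Proof. exact: measurable_fun_pair. Qed.
Let Xs : {mfun T >-> (Z * S)%type} :=
  HB.pack (fun w => (X w, s w)) (isMeasurableFun.Build _ _ _ _ _ mXs).

(** Independence fixes the law of the pair on rectangles, hence makes it the product measure, and
    Tonelli lets the second variable be integrated with the first one frozen. *)
Lemma integral_joint_law (phi : Z * S -> \bar R) :
  measurable_fun setT phi -> (forall z, 0 <= phi z)%E ->
  (\int[P]_w phi (X w, s w) = \int[P]_w \int[nu]_z phi (X w, z))%E.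
Proof.
move=> mphi phi0.
pose m1 := distribution P X'.
have E : forall A, measurable A -> (m1 \x nu)%E A = distribution P Xs A.
  by apply: product_measure_unique => A B mA mB; exact: indep.
transitivity (\int[distribution P Xs]_z phi z)%E.
  by rewrite ge0_integral_pushforward.
transitivity (\int[m1 \x nu]_z phi z)%E.
  by apply: eq_measure_integral => A mA _; exact/esym/E.
rewrite fubini_tonelli1// /fubini_F.
rewrite ge0_integral_pushforward//; first exact: measurable_fun_fubini_tonelli_F.
by move=> z _; apply: integral_ge0.
Qed.

End joint_law.

Section joint_law_mean0.
Context {R : realType} d d1 d2 (T : measurableType d) (Z : measurableType d1)
  (S : measurableType d2) (P : probability T R) (nu : probability S R).
Context (X : T -> Z) (s : T -> S).
Hypotheses (mX : measurable_fun setT X) (ms : measurable_fun setT s).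
Hypothesis indep : forall A B, measurable A -> measurable B ->
  (P (X @^-1` A `&` s @^-1` B) = P (X @^-1` A) * nu B)%E.

Lemma integral_joint_law_le (phi : Z * S -> \bar R) (c : R) :
  measurable_fun setT phi -> (forall z, 0 <= phi z)%E ->
  (forall w, \int[nu]_z phi (X w, z) <= c%:E)%E ->
  (\int[P]_w phi (X w, s w) <= c%:E)%E.
Proof.
move=> mphi phi0 phic; rewrite (integral_joint_law mX ms indep)//.
apply: (@le_trans _ _ (\int[P]_w (cst c%:E w))%E).
  by apply: ge0_le_integralT => // w; apply: integral_ge0.
by rewrite integral_cst//= probability_setT mule1.
Qed.

Lemma integrable_joint_law (phi : Z * S -> R) (c : R) :
  measurable_fun setT phi ->
  (forall w, \int[nu]_z `|phi (X w, z)|%:E <= c%:E)%E ->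
  P.-integrable setT (fun w => (phi (X w, s w))%:E).
Proof.
move=> mphi phic; apply/integrableP; split.
  apply/measurable_EFinP; apply: (measurableT_comp mphi).
  exact: measurable_fun_pair.
apply: le_lt_trans (ltry c).
apply: (@integral_joint_law_le (fun z => `|phi z|%:E)) => //.
by apply/measurable_EFinP; exact: measurableT_comp.
Qed.

(** Tonelli is applied to the positive and negative parts separately. Their inner integrals agree
    because the inner mean vanishes; the uniform bound [c] keeps the outer integrals finite, so
    their difference is 0 and not [oo - oo]. *)
Lemma integral_joint_law_mean0 (phi : Z * S -> R) (c : R) :
  measurable_fun setT phi ->
  (forall w, \int[nu]_z `|phi (X w, z)|%:E <= c%:E)%E ->
  (forall w, \int[nu]_z (phi (X w, z))%:E = 0)%E ->
  (\int[P]_w (phi (X w, s w))%:E = 0)%E.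
Proof.
move=> mphi phic phim.
have mE : measurable_fun setT (EFin \o phi) by exact/measurable_EFinP.
have Ip w : nu.-integrable setT (fun z => (phi (X w, z))%:E).
  apply/integrableP; split; last exact: le_lt_trans (phic w) (ltry c).
  by apply/measurable_EFinP; exact: measurable_fun_pair2.
have pn w : (\int[nu]_z (EFin \o phi)^\+ (X w, z) =
             \int[nu]_z (EFin \o phi)^\- (X w, z))%E.
  pose g z := (phi (X w, z))%:E.
  have -> : (fun z => (EFin \o phi)^\+ (X w, z))%E = g^\+%E.
    by apply/funext => z; rewrite !funeposE.
  have -> : (fun z => (EFin \o phi)^\- (X w, z))%E = g^\-%E.
    by apply/funext => z; rewrite !funenegE.
  have fa := integrable_pos_fin_num measurableT (Ip w).
  have fb := integrable_neg_fin_num measurableT (Ip w).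
  have := phim w; rewrite integralE -/g -(fineK fa) -(fineK fb) -EFinB => -[ab].
  by congr EFin; exact: subr0_eq.
have fN := integrable_neg_fin_num measurableT (integrable_joint_law mphi phic).
rewrite integralE.
pose f w := (phi (X w, s w))%:E; rewrite -/f.
suff -> : (\int[P]_w f^\+ w = \int[P]_w f^\- w)%E by rewrite subee.
have -> : f^\+%E = (fun w => (EFin \o phi)^\+ (X w, s w))%E.
  by apply/funext => w; rewrite !funeposE.
have -> : f^\-%E = (fun w => (EFin \o phi)^\- (X w, s w))%E.
  by apply/funext => w; rewrite !funenegE.
rewrite (integral_joint_law mX ms indep (measurable_funepos mE))//.
rewrite (integral_joint_law mX ms indep (measurable_funeneg mE))//.
by under eq_integral do rewrite pn.
Qed.

End joint_law_mean0.

(** * Independence of a seed from its past *)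

Section history.
Context {R : realType} d d2 (T : measurableType d)
  (S : measurableType d2) (P : probability T R) (nu : probability S R).
Context (omega : nat -> T -> S).
Hypothesis omega_iid : iid_seeds P nu omega.

(** Only the cylinder events, not the sigma-algebra that they generate: they are stable under
    intersection, as the uniqueness theorem for measures requires. Seed [t] itself is excluded, so
    for [t <= 1] the whole space is the only event. *)
Definition history (t : nat) : set (set T) :=
  [set E | exists2 A : nat -> set S, forall i, measurable (A i) &
    E = \bigcap_(i in [set i | (1 <= i < t)%N]) omega i @^-1` A i].

Let m_omega i : (1 <= i)%N -> measurable_fun setT (omega i).
Proof. by case: omega_iid => + _ _; apply. Qed.

Lemma history_measurable t : history t `<=` measurable.
Proof.
move=> _ [A mA ->]; apply: bigcap_measurableType => i /= /andP[i1 _].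
by rewrite -[X in measurable X]setTI; exact: m_omega.
Qed.

Lemma sigma_history_measurable t : <<s history t >> `<=` measurable.
Proof.
by apply: smallest_sub; [exact: sigma_algebra_measurable|exact: history_measurable].
Qed.

Lemma history_mono t : <<s history t >> `<=` <<s history t.+1 >>.
Proof.
apply: smallest_sub; first exact: smallest_sigma_algebra.
move=> _ [A mA ->]; apply: sub_sigma_algebra.
exists (fun i => if (i < t)%N then A i else setT) => [i|].
  by case: ifP.
apply/seteqP; split => w /= Aw i /=.
  move=> /andP[i1 it]; case: ifP => // lit; apply: Aw; exact/andP.
by move=> /andP[i1 it]; have := Aw i; rewrite /= it i1 ltnS (ltnW it)/=; apply.
Qed.

Lemma history_seed_measurable t : (1 <= t)%N ->
  measurable_fun setT (omega t : g_sigma_algebraType (history t.+1) -> S).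
Proof.
move=> t1 _ B mB; rewrite setTI; apply: sub_sigma_algebra.
exists (fun i => if i == t then B else setT) => [i|]; first by case: ifP.
apply/seteqP; split => w /= Bw.
  by move=> i /= _; case: eqP => // ->.
by have := Bw t; rewrite /= eqxx t1 ltnSn; apply.
Qed.

Lemma prob_history_seed t E B : (1 <= t)%N -> history t E -> measurable B ->
  (P (E `&` omega t @^-1` B) = P E * nu B)%E.
Proof.
move=> t1 [A mA ->] mB.
have [_ omega_law omega_indep] := omega_iid.
have [J JE] : exists J : {fset nat}, forall i, (i \in J) = (1 <= i < t)%N.
  by exists [fset i in iota 1 t.-1]%fset => i; rewrite !inE mem_iota add1n prednK.
have setJ : [set` J] = [set i | (1 <= i < t)%N].
  by apply/seteqP; split => i /=; rewrite JE.
have tJ : t \notin J by rewrite JE ltnn andbF.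
have := omega_indep J A; rewrite setJ => ->//; last by move=> i /= /andP[].
rewrite -(omega_law t B)//.
pose A' i := if i == t then B else A i.
have := omega_indep (t |` J)%fset A'.
have A't : A' t = B by rewrite /A' eqxx.
have prodE : (\prod_(i <- J) P (omega i @^-1` A' i) =
              \prod_(i <- J) P (omega i @^-1` A i))%E.
  apply: eq_big_seq => i iJ; rewrite /A'; case: eqP => // it.
  by rewrite it (negbTE tJ) in iJ.
rewrite big_fsetU1//= A't prodE [RHS]muleC.
move=> <-.
- congr (P _); apply/seteqP; split => w /=.
    move=> [Aw Bw] i /=; rewrite !inE JE => /orP[/eqP ->|it].
      by rewrite /A' eqxx.
    rewrite /A'; case: eqP => [->//|_]; exact: Aw.
  move=> Aw; split; last by have := Aw t; rewrite /= !inE eqxx /A' eqxx; apply.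
  move=> i /= it; have := Aw i; rewrite /= !inE JE it orbT /A' => /(_ isT).
  by case: eqP => // ie; move: it; rewrite ie ltnn andbF.
- by move=> i /=; rewrite !inE JE => /orP[/eqP ->//|/andP[]].
- by move=> i; rewrite /A'; case: ifP.
Qed.

(** Both sides are finite measures in [E]: [P] restricted to the event of seed [t], and [P] scaled
    by [nu B]. They agree on the cylinders, which are stable under intersection and include the
    whole space. *)
Lemma history_seed_independent t E B : (1 <= t)%N -> <<s history t >> E ->
  measurable B -> (P (E `&` omega t @^-1` B) = P E * nu B)%E.
Proof.
move=> t1 sE mB.
have mtB : measurable (omega t @^-1` B).
  by rewrite -[X in measurable X]setTI; exact: m_omega.
have nuB0 : 0 <= fine (nu B) by rewrite fine_ge0.
pose m1 := mrestr P mtB.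
pose m2 := mscale (NngNum nuB0) P.
have m2E A : m2 A = (P A * nu B)%E.
  have fB : nu B \is a fin_num by exact: fin_num_measure.
  by rewrite muleC -[in RHS](fineK fB).
rewrite -m2E.
apply: (@g_sigma_algebra_measure_unique _ _ _ (history t) (@history_measurable t)
  (fun=> setT) _ _ m1 m2) => //.
- move=> _; exists (fun=> setT) => //.
  by apply/seteqP; split.
- by apply/seteqP; split => // w _; exists 0%N.
- move=> _ _ [A mA ->] [A' mA' ->]; exists (fun i => A i `&` A' i).
    by move=> i; exact: measurableI.
  by rewrite -bigcapI.
- by move=> A hA; apply: etrans (esym (m2E A)); exact: prob_history_seed.
- by move=> _; exact: le_lt_trans (probability_le1 P (measurableI _ _ measurableT mtB)) (ltry 1).
Qed.

End history.

(** * Stochastic mirror descent *)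

Section stochastic_mirror_descent.
Context {R : realType} {n : nat} {V : normedModType R} (F : coord_frame V n).
Context (X : set V) (Xcompact : compact X).
Context (f : V -> \bar R) (gradf : V -> {linear V -> R^o}).
Hypothesis ffin : forall x, X x -> f x \is a fin_num.
Hypothesis gradfP : continuous_selection f gradf.
Context (h : V -> \bar R) (gradh : V -> {linear V -> R^o}) (K : R).
Hypotheses (hconvex : econvex h) (hdom : edom h = X)
  (hcont : {within X, continuous h}) (gradhP : continuous_selection h gradh)
  (K0 : 0 < K)
  (hstrong : forall x x', dom_subdiff h x -> X x' ->
     (h x + (gradh x (x' - x)%R)%:E + (K / 2 * `|x' - x| ^+ 2)%R%:E <= h x')%E)
  (gradf_def : dom_subdiff h `<=` dom_subdiff f)
  (hsteep : steep X h).
Context d (Omega : measurableType d) (P : probability Omega R)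
  dS (S : measurableType dS) (nu : probability S R)
  (omega : nat -> Omega -> S).
Hypothesis omega_iid : iid_seeds P nu omega.
Context (U : V -> S -> {linear V -> R^o}) (p sigma : R).
Hypotheses (Umeas : measurable_oracle (dom_subdiff h) U)
  (p12 : 1 < p <= 2)
  (Umean : forall x, dom_subdiff f x ->
     forall v, ('E_nu[fun s => U x s v] = 0)%E)
  (Umoment : forall x, dom_subdiff f x ->
     ('E_nu[fun s => (dual_norm (U x s) `^ p)%R] <= (sigma `^ p)%R%:E)%E).
Context (gamma : nat -> R) (y : nat -> Omega -> {linear V -> R^o})
  (x : nat -> Omega -> V).
Hypothesis xy_lmd : lmd X h gradf omega U gamma y x.

Local Notation e := (frame_vec F).
Local Notation D := (dom_subdiff h).

(** * Adaptedness of the iterates to the seeds *)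

Lemma iterate_subdiff t w : (1 <= t)%N -> subdiff h (x t w) (y t w).
Proof.
move=> t1; apply: (mirror_map_subdiff hconvex hdom).
by case: xy_lmd => _ _; apply.
Qed.

Lemma iterate_dom t w : (1 <= t)%N -> D (x t w).
Proof. by move=> t1; exists (y t w); exact: iterate_subdiff. Qed.

Lemma dom_subdiff_measurable : measurable (D : set (borel V)).
Proof. by rewrite hsteep; exact: relint_measurable. Qed.

Lemma gradf_measurable v :
  measurable_fun (D : set (borel V)) (fun z : borel V => gradf z v : R).
Proof.
apply: within_cvg_measurable => z Dz.
apply: cvg_trans (selection_cvg F (v := v) gradfP (gradf_def Dz)).
by apply: cvg_app; exact: within_subset.
Qed.

Lemma h_measurable : measurable_fun (D : set (borel V)) (fun z : borel V => fine (h z)).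
Proof.
apply: within_cvg_measurable => z Dz; have Xz := dom_subdiff_sub hsteep Dz.
apply: fine_cvg; rewrite fineK; last exact: (fin_num_dom hconvex hdom).
apply: cvg_trans ((subspace_continuousP _ _).1 hcont _ Xz).
by apply: cvg_app; apply: within_subset => u /(dom_subdiff_sub hsteep).
Qed.

Lemma measurable_on_dom d' (T : measurableType d') (g : V -> R) (q : T -> V) :
  measurable_fun (D : set (borel V)) (g : borel V -> R) ->
  measurable_fun setT (q : T -> borel V) -> (forall w, D (q w)) ->
  measurable_fun setT (fun w => g (q w)).
Proof.
move=> mg mq Dq.
apply: (@measurable_comp _ _ _ _ (borel V) _ (D : set (borel V)) g setT q) => //.
  exact: dom_subdiff_measurable.
by move=> _ [w _ <-].
Qed.

Lemma oracle_measurable d' (T : measurableType d') (q : T -> V) (s : T -> S) v :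
  measurable_fun setT (q : T -> borel V) -> measurable_fun setT s ->
  (forall w, D (q w)) -> measurable_fun setT (fun w => U (q w) (s w) v : R).
Proof.
move=> mq ms Dq.
apply: (@measurable_comp _ _ _ _ (borel V * S)%type _
  ((D : set (borel V)) `*` [set: S])
  (fun z : borel V * S => U z.1 z.2 v : R) setT (fun w => (q w, s w))) => //.
- by apply: measurableX => //; exact: dom_subdiff_measurable.
- by move=> _ [w _ <-]; split => //=; exact: Dq.
- exact: measurable_fun_pair.
Qed.

(** [T] serves to put another sigma-algebra on [Omega]: the lemma is used with [emb] the identity
    and [T] carrying a seed history. *)
Lemma iterate_measurable_of_dual d' (T : measurableType d') (t : nat)
    (emb : T -> Omega) : (1 <= t)%N ->
  (forall v, measurable_fun setT (fun w => y t (emb w) v : R)) ->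
  measurable_fun setT (fun w => x t (emb w) : borel V).
Proof.
move=> t1 my.
apply: (@measurable_fun_of_coords _ _ _ _ _ (fun i w => y t (emb w) (e i)) _
  (frame_bound F / K)) => //.
  by rewrite divr_ge0// ltW// frame_bound_gt0.
move=> w w'; rewrite mulrAC ler_pdivlMr// mulrC.
exact: (mirror_map_lipschitz F hconvex hdom gradhP hsteep hstrong
  (iterate_subdiff (emb w) t1) (iterate_subdiff (emb w') t1)).
Qed.

Local Notation FT t := (g_sigma_algebraType (history omega t)).

Lemma dual_history_measurable t : (1 <= t)%N -> forall v,
  measurable_fun setT (fun w : FT t => y t w v : R).
Proof.
elim: t => // -[_ _ v|t IH _ v].
  have [y1 _ _] := xy_lmd.
  by rewrite (_ : (fun w => _) = cst 0)//; apply/funext => w; exact: y1.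
set u := t.+1 in IH *.
(* Step [u] consumes seed [u], which enters the history only at [u.+1]; what is known at [u] is
   therefore lifted to the larger sigma-algebra. *)
have my v' : measurable_fun setT (fun w : FT u.+1 => y u w v' : R).
  move=> _ A mA; apply: history_mono; exact: (IH isT v' measurableT A mA).
have mx := @iterate_measurable_of_dual _ (FT u.+1) u id isT my.
have ms := history_seed_measurable (isT : (1 <= u)%N) : measurable_fun setT (omega u : FT u.+1 -> S).
have [_ yS _] := xy_lmd.
rewrite (_ : (fun w => _) =
  (fun w => y u w v - gamma u * (gradf (x u w) v + U (x u w) (omega u w) v))); last first.
  by apply/funext => w; exact: yS.
apply: measurable_funB; first exact: my.
apply: measurable_funM; first exact: measurable_cst.
apply: measurable_funD.
  apply: (@measurable_on_dom _ _ (gradf ^~ v)) => //; first exact: gradf_measurable.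
  by move=> w; exact: iterate_dom.
by apply: oracle_measurable => // w; exact: iterate_dom.
Qed.

Lemma iterate_history_measurable t : (1 <= t)%N ->
  measurable_fun setT (fun w : FT t => x t w : borel V).
Proof.
by move=> t1; apply: (@iterate_measurable_of_dual _ (FT t) t id) => //; exact: dual_history_measurable.
Qed.

Lemma history_measurable_fun t d' (T : measurableType d') (g : Omega -> T) :
  measurable_fun setT (g : FT t -> T) -> measurable_fun setT g.
Proof.
move=> mg _ A mA; apply: (sigma_history_measurable omega_iid (t := t)).
exact: mg.
Qed.

Lemma dual_measurable t v : (1 <= t)%N -> measurable_fun setT (fun w => y t w v : R).
Proof. by move=> t1; apply: (@history_measurable_fun t); exact: dual_history_measurable. Qed.

Lemma iterate_measurable t : (1 <= t)%N -> measurable_fun setT (x t : Omega -> borel V).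
Proof. by move=> t1; apply: (@history_measurable_fun t); exact: iterate_history_measurable. Qed.

Lemma seed_measurable t : (1 <= t)%N -> measurable_fun setT (omega t).
Proof. by case: omega_iid => + _ _; apply. Qed.

Lemma iterate_seed_independent t A B : (1 <= t)%N ->
  measurable (A : set (borel V)) -> measurable B ->
  (P (x t @^-1` A `&` omega t @^-1` B) = P (x t @^-1` A) * nu B)%E.
Proof.
move=> t1 mA mB; apply: (history_seed_independent omega_iid) => //.
by rewrite -[X in (<<s _ >>) X]setTI; exact: iterate_history_measurable.
Qed.

Lemma dual_pairing_measurable t xs : (1 <= t)%N ->
  measurable_fun setT (fun w => y t w (xs - x t w) : R).
Proof.
move=> t1.
rewrite (_ : (fun w => _) =
  (fun w => \sum_i frame_coord F i (xs - x t w) * y t w (e i))); last first.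
  by apply/funext => w; exact: linear_frame.
apply: measurable_sum => i; apply: measurable_funM; last exact: dual_measurable.
apply: (measurableT_comp (frame_coord_measurable F i xs)).
exact: iterate_measurable.
Qed.

Lemma fenchel_measurable t xs : (1 <= t)%N ->
  measurable_fun setT (fun w => fenchel h xs (x t w) (y t w)).
Proof.
move=> t1; apply: measurable_funB; last exact: dual_pairing_measurable.
apply: measurable_funB => //; apply: (@measurable_on_dom _ _ (fine \o h)).
- exact: h_measurable.
- exact: iterate_measurable.
- by move=> w; exact: iterate_dom.
Qed.

(** * Noise moments and the recursion in expectation *)

Context (mu L : R) (xs : V) (diam : R).
Hypotheses (fstrong : rel_strongly_convex X f h gradf gradh mu)
  (fsmooth : rel_smooth X f h gradf gradh L)
  (xsmin : minimizer_over X f xs)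
  (diam0 : 0 < diam) (Xdiam : forall u v, X u -> X v -> `|u - v| <= diam)
  (gamma0 : forall t, (1 <= t)%N -> 0 <= gamma t)
  (gammaL : forall t, (1 <= t)%N -> gamma t * L <= p^-1).

(** Normalization for which [frame_norm / scale <= dual_norm], so that the moment bound keeps the
    constant [sigma ^ p]; the summand 1 makes it positive. *)
Let scale := 1 + \sum_i `|e i|.
Let scale0 : 0 < scale. Proof. by rewrite ltr_pwDl// sumr_ge0. Qed.
Let p0 : 0 < p. Proof. by move: p12; lra. Qed.

(* [frame_norm] replaces [dual_norm] in the moment bound because it is
   measurable by construction. *)
Let oracle_pow (z : borel V) s := (frame_norm F (U z s) / scale) `^ p.

Lemma oracle_pow_ge0 z s : 0 <= oracle_pow z s.
Proof. exact: powR_ge0. Qed.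

(** Extension by 0 outside the domain where the oracle is measurable, because the joint-law lemmas
    take total functions. The iterates never leave that domain. *)
Let on_dom (g : borel V * S -> R) := g \_ ((D : set (borel V)) `*` [set: S]).

Let on_domE g z s : D z -> on_dom g (z, s) = g (z, s).
Proof. by move=> Dz; rewrite /on_dom patchE ifT// inE. Qed.

Let on_dom_measurable g :
  measurable_fun ((D : set (borel V)) `*` [set: S]) g ->
  measurable_fun setT (on_dom g).
Proof.
move=> mg; apply/(measurable_restrictT _ _).1 => //.
by apply: measurableX => //; exact: dom_subdiff_measurable.
Qed.

Let frame_norm_measurable :
  measurable_fun ((D : set (borel V)) `*` [set: S])
    (fun z : borel V * S => frame_norm F (U z.1 z.2) : R).
Proof.
by apply: measurable_sum => i; apply: measurableT_comp => //; exact: Umeas.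
Qed.

Let oracle_pow_measurable :
  measurable_fun setT (on_dom (fun z => oracle_pow z.1 z.2)).
Proof.
apply: on_dom_measurable.
apply: (@measurableT_comp _ _ _ _ _ _ (fun r : R => r `^ p)).
  exact: measurable_powR.
by apply: measurable_funM; [exact: frame_norm_measurable|exact: measurable_cst].
Qed.

Lemma oracle_pow_moment z : D z ->
  (\int[nu]_s (oracle_pow z s)%:E <= (sigma `^ p)%:E)%E.
Proof.
move=> Dz; have := Umoment (gradf_def Dz); rewrite unlock; apply: le_trans.
apply: ge0_le_integralT => s; first by rewrite lee_fin oracle_pow_ge0.
rewrite lee_fin; apply: ge0_ler_powR; first exact: ltW.
- by rewrite nnegrE divr_ge0 ?frame_norm_ge0// ltW.
- by rewrite nnegrE; exact: (dual_norm_ge0 F).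
- by rewrite ler_pdivrMr// mulrC; exact: frame_norm_le_dual.
Qed.

Lemma oracle_pairing_measurable :
  measurable_fun setT (on_dom (fun z => U z.1 z.2 (xs - z.1))).
Proof.
apply: on_dom_measurable.
rewrite (_ : (fun z => _) = (fun z : borel V * S =>
  \sum_i frame_coord F i (xs - z.1) * U z.1 z.2 (e i))); last first.
  by apply/funext => z; exact: linear_frame.
apply: measurable_sum => i; apply: measurable_funM; last exact: Umeas.
apply: measurable_funTS.
exact: (measurableT_comp (frame_coord_measurable F i xs) measurable_fst).
Qed.

(** From [r <= 1 + r^p] for [r >= 0]: the p-th moment bound then yields integrability of the
    pairing. *)
Lemma oracle_pairing_le z v s :
  `|U z s v| <= frame_bound F * scale * `|v| * (1 + oracle_pow z s).
Proof.
apply: le_trans (frame_norm_bound F _ _) _.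
rewrite -!mulrA ler_wpM2l ?(ltW (frame_bound_gt0 F))//.
set N := frame_norm F _.
have N0 : 0 <= N / scale by rewrite divr_ge0 ?frame_norm_ge0// ltW.
have -> : N * `|v| = scale * (`|v| * (N / scale)) by field; rewrite gt_eqF.
rewrite !ler_wpM2l ?(ltW scale0)// /oracle_pow -/N.
have [N1|N1] := leP (N / scale) 1; first by rewrite (le_trans N1)// lerDl powR_ge0.
apply: le_trans (le1r_powR (ltW N1) (_ : 1 <= p)) _; last by rewrite lerDr.
by move: p12; lra.
Qed.

Let oracle_bound := frame_bound F * scale * diam * (1 + sigma `^ p).

Lemma oracle_pairing_integrable z : D z ->
  (\int[nu]_s (`|U z s (xs - z)|%:E) <= oracle_bound%:E)%E.
Proof.
move=> Dz; have Xz := dom_subdiff_sub hsteep Dz.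
set c := frame_bound F * scale * diam.
have c0 : 0 <= c by rewrite !mulr_ge0 ?(ltW (frame_bound_gt0 F)) ?(ltW scale0)// ltW.
apply: (@le_trans _ _ (\int[nu]_s (c%:E * (1 + (oracle_pow z s)%:E)))%E).
  apply: ge0_le_integralT => s //; rewrite -EFinD -EFinM lee_fin.
  apply: le_trans (oracle_pairing_le _ _ _) _.
  rewrite ler_wpM2r ?addr_ge0 ?oracle_pow_ge0// ler_wpM2l//.
    by rewrite mulr_ge0 ?(ltW (frame_bound_gt0 F)) ?(ltW scale0).
  by apply: Xdiam => //; case: xsmin.
have mo : measurable_fun setT (fun s => (oracle_pow z s)%:E).
  apply/measurable_EFinP.
  apply: (eq_measurable_fun (fun s => on_dom (fun z => oracle_pow z.1 z.2) (z, s))).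
    by move=> s _; rewrite on_domE.
  exact: (@measurable_fun_pair2 _ _ _ _ _ _ _ (z : borel V) oracle_pow_measurable).
rewrite ge0_integralZl//.
- rewrite ge0_integralD//; last by move=> s _; rewrite lee_fin oracle_pow_ge0.
  rewrite integral_cst//= probability_setT mul1e.
  have -> : oracle_bound%:E = (c%:E * (1 + (sigma `^ p)%:E))%E by [].
  by rewrite lee_wpmul2l ?lee_fin// leeD2l// oracle_pow_moment.
- by apply: emeasurable_funD.
- by move=> s _; rewrite adde_ge0// lee_fin oracle_pow_ge0.
Qed.

Lemma noise_integrable t : (1 <= t)%N ->
  P.-integrable setT (fun w => (U (x t w) (omega t w) (xs - x t w))%:E).
Proof.
move=> t1.
rewrite (_ : (fun w => _) =
  (fun w => (on_dom (fun z => U z.1 z.2 (xs - z.1)) (x t w, omega t w))%:E)); last first.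
  by apply/funext => w; rewrite on_domE//; exact: iterate_dom.
apply: (@integrable_joint_law _ _ _ _ _ (borel V) _ P nu (x t) (omega t)
  (iterate_measurable t1) (seed_measurable t1)
  (fun A B => @iterate_seed_independent t A B t1)
  (on_dom (fun z => U z.1 z.2 (xs - z.1))) oracle_bound).
  exact: oracle_pairing_measurable.
move=> w; apply: le_trans (oracle_pairing_integrable (iterate_dom w t1)).
by apply: ge0_le_integralT => // s; rewrite on_domE//; exact: iterate_dom.
Qed.

Lemma noise_mean0 t : (1 <= t)%N ->
  (\int[P]_w (U (x t w) (omega t w) (xs - x t w))%:E = 0)%E.
Proof.
move=> t1.
transitivity (\int[P]_w
  (on_dom (fun z => U z.1 z.2 (xs - z.1)) (x t w, omega t w))%:E)%E.
  by apply: eq_integral => w _; rewrite on_domE//; exact: iterate_dom.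
apply: (@integral_joint_law_mean0 _ _ _ _ _ (borel V) _ P nu (x t) (omega t)
  (iterate_measurable t1) (seed_measurable t1)
  (fun A B => @iterate_seed_independent t A B t1)
  (on_dom (fun z => U z.1 z.2 (xs - z.1))) oracle_bound).
- exact: oracle_pairing_measurable.
- move=> w; apply: le_trans (oracle_pairing_integrable (iterate_dom w t1)).
  by apply: ge0_le_integralT => // s; rewrite on_domE//; exact: iterate_dom.
- move=> w; have := Umean (gradf_def (iterate_dom w t1)) (xs - x t w).
  rewrite unlock => <-.
  by apply: eq_integral => s _; rewrite on_domE//; exact: iterate_dom.
Qed.

Lemma oracle_pow_expectation t : (1 <= t)%N ->
  (\int[P]_w (oracle_pow (x t w) (omega t w))%:E <= (sigma `^ p)%:E)%E.
Proof.
move=> t1.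
rewrite (_ : (fun w => _) =
  (fun w => (EFin \o on_dom (fun z => oracle_pow z.1 z.2)) (x t w, omega t w))); last first.
  by apply/funext => w /=; rewrite on_domE//; exact: iterate_dom.
apply: (@integral_joint_law_le _ _ _ _ _ (borel V) _ P nu (x t) (omega t)
  (iterate_measurable t1) (seed_measurable t1)
  (fun A B => @iterate_seed_independent t A B t1)
  (EFin \o on_dom (fun z => oracle_pow z.1 z.2))).
- exact/measurable_EFinP.
- by move=> z; rewrite lee_fin /on_dom patchE; case: ifP => // _; exact: oracle_pow_ge0.
- move=> w; apply: le_trans (oracle_pow_moment (iterate_dom w t1)).
  apply: ge0_le_integralT => s; rewrite /= on_domE ?lee_fin//=.
  + exact: oracle_pow_ge0.
  + exact: iterate_dom.
  + exact: iterate_dom.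
Qed.

Lemma oracle_pow_measurable_iterate t : (1 <= t)%N ->
  measurable_fun setT (fun w => oracle_pow (x t w) (omega t w)).
Proof.
move=> t1.
rewrite (_ : (fun w => _) =
  (on_dom (fun z => oracle_pow z.1 z.2) \o (fun w => (x t w, omega t w)))); last first.
  by apply/funext => w /=; rewrite on_domE//; exact: iterate_dom.
apply: measurableT_comp => //.
by apply: measurable_fun_pair; [exact: iterate_measurable|exact: seed_measurable].
Qed.

Lemma oracle_pow_integrable t : (1 <= t)%N ->
  P.-integrable setT (fun w => (oracle_pow (x t w) (omega t w))%:E).
Proof.
move=> t1; apply/integrableP; split.
  by apply/measurable_EFinP; exact: oracle_pow_measurable_iterate.
under eq_integral do rewrite gee0_abs ?lee_fin ?oracle_pow_ge0//.
exact: le_lt_trans (oracle_pow_expectation t1) (ltry _).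
Qed.

(** The constant of [young_bounded] for [c = (1 - 1/p) K/2] and [D = diam]; the last factor converts
    [frame_bound F] times the frame norm of the noise into the normalized quantity inside
    [oracle_pow]. *)
Let young_const := diam `^ (2 - p) / ((1 - p^-1) * (K / 2)) `^ (p - 1) *
  (frame_bound F * scale) `^ p.

Lemma young_const_ge0 : 0 <= young_const.
Proof. by rewrite mulr_ge0 ?divr_ge0 ?powR_ge0. Qed.

Lemma fenchel_iterate_ge0 t w : (1 <= t)%N -> 0 <= fenchel h xs (x t w) (y t w).
Proof.
move=> t1; have Xxs : X xs by case: xsmin.
exact: (fenchel_ge0 F hconvex hdom gradhP hsteep K0 hstrong Xxs (iterate_subdiff w t1)).
Qed.

Lemma fenchel_step t w : (1 <= t)%N ->
  fenchel h xs (x t.+1 w) (y t.+1 w) <=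
  (1 - gamma t * mu) * fenchel h xs (x t w) (y t w) +
  gamma t * U (x t w) (omega t w) (xs - x t w) +
  young_const * gamma t `^ p * oracle_pow (x t w) (omega t w).
Proof.
move=> t1; have [_ yS _] := xy_lmd.
have g0 := gamma0 t1; have gL := gammaL t1.
have pV1 : p^-1 < 1 by rewrite invf_lt1//; move: p12; lra.
have gL1 : gamma t * L <= 1 by apply: le_trans gL (ltW pV1).
have := mirror_step F hconvex hdom gradhP hsteep hstrong ffin fstrong fsmooth xsmin
  g0 gL1 (iterate_subdiff w t1) (iterate_subdiff w (isT : (1 <= t.+1)%N))
  (yS t w ^~ t1).
move=> /le_trans; apply; rewrite lerD2l.
set N := frame_norm F (U (x t w) (omega t w)).
set r := `|x t.+1 w - x t w|.
have r0 : 0 <= r <= diam.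
  rewrite normr_ge0 Xdiam// ; apply: (dom_subdiff_sub hsteep); exact: iterate_dom.
have c0 : 0 < (1 - p^-1) * (K / 2) by rewrite mulr_gt0 ?divr_gt0 ?subr_gt0.
have BN0 : 0 <= frame_bound F * N.
  by rewrite mulr_ge0 ?frame_norm_ge0// ltW// frame_bound_gt0.
have z0 : 0 <= gamma t * (frame_bound F * N) by rewrite mulr_ge0.
apply: le_trans (_ : _ <= gamma t * (frame_bound F * N) * r
  - (1 - p^-1) * (K / 2) * r ^+ 2) _.
  rewrite lerB//.
    rewrite -mulrA ler_wpM2l// (le_trans (ler_norm _))//.
    by rewrite /r distrC; exact: frame_norm_bound.
  rewrite ler_wpM2r ?sqr_ge0// ler_wpM2r ?divr_ge0 ?(ltW K0)//.
  by rewrite lerB.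
apply: le_trans (young_bounded p12 c0 diam0 r0 z0) _.
rewrite /young_const -!mulrA ler_wpM2l ?powR_ge0// ler_wpM2l ?invr_ge0 ?powR_ge0//.
rewrite /oracle_pow -/N le_eqVlt; apply/orP; left; apply/eqP.
have s1 : 0 <= frame_bound F * scale by rewrite mulr_ge0 ?ltW// frame_bound_gt0.
have Ns : 0 <= N / scale by rewrite divr_ge0 ?frame_norm_ge0// ltW.
rewrite -[in RHS]powRM// -[in RHS](powRM _ s1 (mulr_ge0 g0 Ns)).
congr (_ `^ _).
by field; rewrite gt_eqF.
Qed.

(** By induction: the next divergence lies between 0 and the right-hand side of [fenchel_step],
    whose terms are integrable. *)
Lemma fenchel_integrable t : (1 <= t)%N ->
  P.-integrable setT (fun w => (fenchel h xs (x t w) (y t w))%:E).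
Proof.
have Xxs : X xs by case: xsmin.
elim: t => // -[_ _|t IH _].
  (* Since [y 1 = 0], every [x 1 w] minimizes [h], so the initial divergence is [h xs - min h] for
     every outcome. *)
  have fE w w' : fenchel h xs (x 1 w) (y 1 w) = fenchel h xs (x 1 w') (y 1 w').
    have [y1 _ _] := xy_lmd; rewrite /fenchel !y1; congr (_ - _ - _).
    have Dx u : X (x 1 u) by apply: (dom_subdiff_sub hsteep); exact: iterate_dom.
    have le u u' := subdiff_fine hconvex hdom (Dx u) (Dx u')
      (iterate_subdiff u (isT : (1 <= 1)%N)).
    have := le w w'; have := le w' w; rewrite !y1 !addr0 => h1 h2.
    by apply/eqP; rewrite eq_le h1 h2.
  have [w0|nw] := pselect (exists w0 : Omega, True); last first.
    rewrite (_ : (fun w => _) = cst 0%E); first exact: integrable0.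
    by apply/funext => w; exfalso; apply: nw; exists w.
  case: w0 => w0 _; rewrite (_ : (fun w => _) = cst (fenchel h xs (x 1 w0) (y 1 w0))%:E).
    exact: finite_measure_integrable_cst.
  by apply/funext => w; rewrite (fE w w0).
set u := t.+1 in IH *.
pose g w := (1 - gamma u * mu) * fenchel h xs (x u w) (y u w) +
  gamma u * U (x u w) (omega u w) (xs - x u w) +
  young_const * gamma u `^ p * oracle_pow (x u w) (omega u w).
apply: (@le_integrable _ _ _ P setT measurableT _ (EFin \o g)).
- by apply/measurable_EFinP; exact: fenchel_measurable.
- move=> w _; rewrite /= lee_fin !ger0_norm ?fenchel_step//.
    by apply: le_trans (fenchel_step _ _) => //; exact: fenchel_iterate_ge0.
  exact: fenchel_iterate_ge0.
rewrite (_ : EFin \o g = (fun w => (1 - gamma u * mu)%:E *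
    (fenchel h xs (x u w) (y u w))%:E) \+
  (fun w => (gamma u)%:E * (U (x u w) (omega u w) (xs - x u w))%:E) \+
  (fun w => (young_const * gamma u `^ p)%:E *
    (oracle_pow (x u w) (omega u w))%:E))%E; last by apply/funext.
apply: integrableD => //; last exact/integrableZl/oracle_pow_integrable.
apply: integrableD => //; apply: integrableZl => //; first exact: IH.
exact: noise_integrable.
Qed.

Lemma fenchel_recursion : exists2 C, 0 <= C & forall t, (1 <= t)%N ->
  (\int[P]_w (fenchel h xs (x t.+1 w) (y t.+1 w))%:E <=
   (1 - gamma t * mu)%:E * \int[P]_w (fenchel h xs (x t w) (y t w))%:E +
   (C * gamma t `^ p)%:E)%E.
Proof.
exists (young_const * sigma `^ p).
  by rewrite mulr_ge0 ?young_const_ge0 ?powR_ge0.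
move=> t t1; have Xxs : X xs by case: xsmin.
have If := fenchel_integrable t1.
apply: (@le_trans _ _ (\int[P]_w ((1 - gamma t * mu)%:E *
    (fenchel h xs (x t w) (y t w))%:E +
  (gamma t)%:E * (U (x t w) (omega t w) (xs - x t w))%:E +
  (young_const * gamma t `^ p)%:E * (oracle_pow (x t w) (omega t w))%:E))%E).
  apply: ge0_le_integralT => w.
    by rewrite lee_fin; exact: fenchel_iterate_ge0.
  by rewrite -!EFinM -!EFinD lee_fin fenchel_step.
have I1 : P.-integrable setT (fun w => (1 - gamma t * mu)%:E *
    (fenchel h xs (x t w) (y t w))%:E)%E by exact: integrableZl.
have I2 : P.-integrable setT (fun w => (gamma t)%:E *
    (U (x t w) (omega t w) (xs - x t w))%:E)%E.
  by apply: integrableZl => //; exact: noise_integrable.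
have I3 : P.-integrable setT (fun w => (young_const * gamma t `^ p)%:E *
    (oracle_pow (x t w) (omega t w))%:E)%E.
  by apply: integrableZl => //; exact: oracle_pow_integrable.
rewrite integralD//; last exact: integrableD.
rewrite integralD// integralZl// integralZl//; last exact: noise_integrable.
rewrite noise_mean0// mule0 adde0 integralZl//; last exact: oracle_pow_integrable.
rewrite leeD2l// (mulrAC young_const) [leRHS]EFinM; apply: lee_wpmul2l; last exact: oracle_pow_expectation.
by rewrite lee_fin mulr_ge0 ?powR_ge0// young_const_ge0.
Qed.

Lemma error_le_fenchel t : (1 <= t)%N ->
  ('E_P[fun w => (`|x t w - xs| ^+ 2)%R] <=
   (2 / K)%:E * \int[P]_w (fenchel h xs (x t w) (y t w))%:E)%E.
Proof.
move=> t1; have Xxs : X xs by case: xsmin.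
rewrite unlock -integralZl//; last exact: fenchel_integrable.
apply: ge0_le_integralT => w; first by rewrite lee_fin sqr_ge0.
rewrite -EFinM lee_fin distrC.
have := fenchel_ge F hconvex hdom gradhP hsteep hstrong Xxs (iterate_subdiff w t1).
by rewrite -[2 / K]invf_div ler_pdivlMl ?divr_gt0.
Qed.

End stochastic_mirror_descent.

Theorem theorem9 (R : realType) (n : nat) (V : normedModType R)
  (dimV : Vector.axiom n V)
  (X : set V) (X0 : X !=set0) (Xcompact : compact X) (Xconvex : convex_set X)
  (f : V -> \bar R) (gradf : V -> {linear V -> R^o})
  (fconvex : econvex f)
  (ffin : forall x, X x -> f x \is a fin_num)
  (fcont : {within X, continuous f})
  (gradfP : continuous_selection f gradf)
  (h : V -> \bar R) (gradh : V -> {linear V -> R^o}) (K : R)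
  (hconvex : econvex h)
  (hdom : edom h = X)
  (hcont : {within X, continuous h})
  (gradhP : continuous_selection h gradh)
  (K0 : 0 < K)
  (hstrong : forall x x', dom_subdiff h x -> X x' ->
     (h x + (gradh x (x' - x)%R)%:E + (K / 2 * `|x' - x| ^+ 2)%R%:E <= h x')%E)
  (gradf_def : dom_subdiff h `<=` dom_subdiff f)
  (d : measure_display) (Omega : measurableType d) (P : probability Omega R)
  (dS : measure_display) (S : measurableType dS) (nu : probability S R)
  (omega : nat -> Omega -> S)
  (omega_iid : iid_seeds P nu omega)
  (U : V -> S -> {linear V -> R^o}) (p sigma : R)
  (Umeas : measurable_oracle (dom_subdiff h) U)
  (p12 : 1 < p <= 2) (sigma0 : 0 <= sigma)
  (Umean : forall x, dom_subdiff f x ->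
     forall v, ('E_nu[fun s => U x s v] = 0)%E)
  (Umoment : forall x, dom_subdiff f x ->
     ('E_nu[fun s => (dual_norm (U x s) `^ p)%R] <= (sigma `^ p)%R%:E)%E)
  (mu L beta : R) (xs : V)
  (hsteep : steep X h)
  (mu0 : 0 < mu)
  (fstrong : rel_strongly_convex X f h gradf gradh mu)
  (fsmooth : rel_smooth X f h gradf gradh L)
  (xsmin : minimizer_over X f xs)
  (beta0 : 0 < beta) (betaL : beta <= 1 / (p * L))
  (y : nat -> Omega -> {linear V -> R^o}) (x : nat -> Omega -> V)
  (xy_lmd : lmd X h gradf omega U (fun t => beta / t%:R) y x) :
  let err := fun t => ('E_P[fun w => (`|x t w - xs| ^+ 2)%R])%E in
  [/\ p < 1 + beta * mu ->
        ebigO err (fun t => 1 / t%:R `^ (p - 1)),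
      p = 1 + beta * mu ->
        ebigO err (fun t => ln t%:R / t%:R `^ (p - 1))
    & p > 1 + beta * mu ->
        ebigO err (fun t => 1 / t%:R `^ (beta * mu))].
Proof.
have [F] := coord_frame_exists dimV.
have p0 : 0 < p by move: p12; lra.
have p1 : 1 < p by move: p12; lra.
(* Positivity of [L] is read off [0 < beta <= 1 / (p * L)]; the convention [0^-1 = 0] excludes
   [L = 0]. *)
have L0 : 0 < L.
  rewrite -(pmulr_rgt0 _ p0) -invr_gt0 -[X in _ < X]mul1r.
  exact: lt_le_trans betaL.
have gamma0 t : (1 <= t)%N -> 0 <= beta / t%:R by move=> _; rewrite divr_ge0// ltW.
have gammaL t : (1 <= t)%N -> beta / t%:R * L <= p^-1.
  move=> t1; have bL : beta * L <= p^-1.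
    by move: betaL; rewrite div1r invfM -ler_pdivrMr ?invr_gt0// invrK.
  apply: le_trans bL; rewrite ler_pM2r// ler_pdivrMr ?ltr0n//.
  by rewrite ler_peMr ?(ltW beta0)// ler1n.
have [diam diam0 Xdiam] : exists2 diam, 0 < diam &
    forall u v, X u -> X v -> `|u - v| <= diam.
  have [M [_ HM]] := compact_bounded Xcompact.
  have M1 : M < `|M| + 1 by rewrite (le_lt_trans (ler_norm M))// ltrDl.
  exists (2 * (`|M| + 1)); first by rewrite mulr_gt0// ltr_wpDl.
  move=> u v Xu Xv; apply: le_trans (ler_normB _ _) _.
  by have := HM _ M1 _ Xu; have := HM _ M1 _ Xv; rewrite /=; lra.
have [C C0 rec] := fenchel_recursion F Xcompact ffin gradfP hconvex hdom hcont
  gradhP K0 hstrong gradf_def hsteep omega_iid Umeas p12 Umean Umoment xy_lmd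
  fstrong fsmooth xsmin diam0 Xdiam gamma0 gammaL.
have Xxs : X xs by case: xsmin.
pose a t := fine (\int[P]_w (fenchel h xs (x t w) (y t w))%:E).
have aE t : (1 <= t)%N -> (\int[P]_w (fenchel h xs (x t w) (y t w))%:E = (a t)%:E)%E.
  move=> t1; rewrite fineK//; apply: integrable_fin_num => //.
  exact: (fenchel_integrable F Xcompact ffin gradfP hconvex hdom hcont
    gradhP K0 hstrong gradf_def hsteep omega_iid Umeas p12 Umoment xy_lmd
    fstrong fsmooth xsmin diam0 Xdiam gamma0 gammaL t1).
have a0 t : (0 < t)%N -> 0 <= a t.
  move=> t1; rewrite -lee_fin -aE//; apply: integral_ge0 => w _; rewrite lee_fin.
  exact: (fenchel_iterate_ge0 F hconvex hdom gradhP K0 hstrong hsteep xy_lmd xsmin w t1).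
have b0 : 0 < beta * mu by rewrite mulr_gt0.
have Cb0 : 0 <= C * beta `^ p by rewrite mulr_ge0 ?powR_ge0.
have arec t : (0 < t)%N ->
    a t.+1 <= (1 - beta * mu / t%:R) * a t + C * beta `^ p / t%:R `^ p.
  move=> t1; have := rec t t1; rewrite !aE// -EFinM -EFinD lee_fin.
  have -> : (beta / t%:R) `^ p = beta `^ p / t%:R `^ p.
    rewrite powRM ?invr_ge0 ?ler0n ?(ltW beta0)//; congr (_ * _).
    by rewrite -powR_inv1 ?ler0n// powRAC powR_inv1// powR_ge0.
  by rewrite mulrA (mulrAC beta).
have bigO g : (forall t : nat, (0 < t)%N -> 0 <= g t) ->
    (exists M, 0 <= M /\ \forall t \near \oo, a t <= M * g t) ->
    ebigO (fun t => 'E_P[fun w => (`|x t w - xs| ^+ 2)%R])%E g.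
  move=> g0 [M [M0 Ma]]; exists (2 / K * M); near=> t.
  have t1 : (0 < t)%N by near: t; exact: nbhs_infty_gt.
  rewrite gee0_abs; last first.
    by rewrite unlock; apply: integral_ge0 => w _; rewrite lee_fin sqr_ge0.
  apply: le_trans (error_le_fenchel F Xcompact ffin gradfP hconvex hdom hcont
    gradhP K0 hstrong gradf_def hsteep omega_iid Umeas p12 Umoment xy_lmd
    fstrong fsmooth xsmin diam0 Xdiam gamma0 gammaL t1) _.
  rewrite aE// -EFinM lee_fin -[leRHS]mulrA ler_wpM2l ?divr_ge0 ?(ltW K0)//.
  by rewrite ger0_norm ?g0//; near: t.
split=> pb; apply: bigO => [t t1|].
- by rewrite divr_ge0 ?powR_ge0.
- have [M [M0 HM]] := chung_case_lt p1 b0 Cb0 arec pb.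
  by exists M; split => //; apply: filterS HM => t; rewrite div1r.
- by rewrite divr_ge0 ?powR_ge0// ln_ge0// ler1n.
- exact: (chung_case_eq b0 Cb0 a0 arec pb).
- by rewrite divr_ge0 ?powR_ge0.
- have [M [M0 HM]] := chung_case_gt b0 Cb0 a0 arec pb.
  by exists M; split => //; apply: filterS HM => t; rewrite div1r.
Unshelve. all: by end_near. Qed.
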